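(* Let $P(z)$ be a polynomial of degree $4$ over $\mathbb{C}$ with derivative index at least $2$. Then $P(z)$ is a UPE in $\mathbb{C}$ if and only if $P(z)$ is a CIP.
   Context: The derivative index of a polynomial $P$ is the number of distinct zeros of $P'$. $P$ is a CIP (critically injective polynomial) if $P(d)\neq P(d')$ for any two distinct zeros $d,d'$ of $P'$. A non-constant polynomial $P$ is a UPE in $\mathbb{C}$ if for any two non-constant entire functions $f,g$ on $\mathbb{C}$, the identity $P(f)=P(g)$ implies $f=g$. *)

(* Defs.v *)
From mathcomp Require Import all_boot all_order all_algebra finmap.
From mathcomp Require Import complex.
From mathcomp Require Import all_classical all_reals all_analysis.

Set Implicit Arguments.
Unset Strict Implicit.
Unset Printing Implicit Defensive.

Import Order.TTheory GRing.Theory Num.Theory numFieldNormedType.Exports.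
Local Open Scope classical_set_scope.
Local Open Scope ring_scope.
Local Open Scope complex_scope.

(* [fset_set] is the empty set on infinite sets, so the index of a constant
   polynomial is 0; otherwise P' <> 0 has finitely many zeros. *)
Definition derivative_index (R : realType) (P : {poly R[i]}) : nat :=
  #|` fset_set [set d : R[i] | root P^`() d]|%fset.

Definition is_CIP (R : realType) (P : {poly R[i]}) : Prop :=
  forall d d' : R[i], root P^`() d -> root P^`() d' -> d <> d' ->
    P.[d] <> P.[d'].

(* The casts to [R[i]^o] select the normed R[i]-module structure on R[i], so
   that this is the limit of the difference quotient over complex increments,
   not derivability over R. *)
Definition entire (R : realType) (f : R[i] -> R[i]) : Prop :=
  forall z : R[i], derivable (f : R[i]^o -> R[i]^o) z 1.

Definition nonconstant (R : realType) (f : R[i] -> R[i]) : Prop :=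
  ~ exists c : R[i], forall z : R[i], f z = c.

(* [1 < size P] says that P is not constant. *)
Definition is_UPE (R : realType) (P : {poly R[i]}) : Prop :=
  (1 < size P)%N /\
  forall f g : R[i] -> R[i],
    entire f -> entire g -> nonconstant f -> nonconstant g ->
    (forall z : R[i], P.[f z] = P.[g z]) -> forall z : R[i], f z = g z.

(* Main.v *)
Require Import Defs.
From mathcomp Require Import all_boot all_order all_algebra.
From mathcomp Require Import complex.
From mathcomp Require Import all_classical all_reals all_analysis.
From mathcomp Require Import ring lra.

(** The easy direction is a symmetry.  After translating the variable,
    [P = k (X^4 + a X^2 + b X + c)].  If two distinct critical points share
    their critical value, then they are opposite and [b = 0]
    ([quartic_symmetric]), so [P] is even about their midpoint, and the identity
    together with the reflection in this midpoint is a pair of distinct entire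
    functions with the same image under [P].

    Conversely, critical injectivity together with the existence of two critical
    points forces [b <> 0].  Suppose that [P(f) = P(g)] with [f] and [g]
    different.  The factor [f - g] of [P(f) - P(g)] can be cancelled by the
    identity theorem, and with [u = f + g], [v = f - g] what is left reads
    [u v^2 = - (u^3 + 2 a u + 2 b)].  As [b <> 0], the function [u] has no
    zero.  It also ramifies over a simple root [al] of the cubic: where
    [u = al], the identity gives [v = 0], and differentiating it gives [u' = 0].
    So [u] omits 0 and infinity and is totally ramified over [al], and a
    function of this kind is constant, because the defects add up to
    [1 + 1 + 1/2 > 2].  Then [v], hence [f], is constant as well.

    The constancy of [u] ([curve_unit_const]) is obtained by Landau's method.
    Write [u = al exp (2 pi i K)] with [K] entire.  Then [K] is ramified over
    every integer, and over 1 and -1 even to an even order, so that [K^2 - 1] is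
    a square on every disc ([holo_sqrt]) and [K = cosh m] there.  The function
    [m] is ramified wherever [cosh m] is an integer at least 2.  Such values of
    [m] come within bounded distance of every point of the plane
    ([cosh_int_dense]), whereas Bloch's theorem ([bloch]) makes [m] cover, by
    points where [m' <> 0], discs whose radius grows with that of the domain of
    [m].  This forces [K' = 0] everywhere ([ramified_const]).

    The complex analysis behind this is developed from complex
    differentiability alone.  Goursat's argument on triangles ([goursat]) gives
    primitives on convex open sets, also when differentiability fails at one
    point ([star_primitive]).  Applied to a difference quotient this yields
    Cauchy's formula on circles ([cauchy_formula]), hence the holomorphy of the
    derivative, Cauchy's estimate, the divisibility of a function by its zeros,
    the identity theorem and logarithms. *)

Set Implicit Arguments.
Unset Strict Implicit.
Unset Printing Implicit Defensive.

Import Order.TTheory GRing.Theory Num.Theory numFieldNormedType.Exports.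
Local Open Scope classical_set_scope.
Local Open Scope ring_scope.
Local Open Scope complex_scope.

(** * The modulus of a complex number and continuity *)

Section Modulus.
Variable R : realType.
Local Notation C := (R[i]^o).
Implicit Types z w : C.

(** The modulus as a real number: the norm of [R[i]] takes its values in [R[i]]
    itself, whose partial order is awkward in estimates. *)
Definition cabs (z : C) : R := Normc.normc z.
Arguments cabs : simpl never.

Lemma normcE_cabs z : `|z| = (cabs z)%:C :> R[i]. Proof. by []. Qed.
Lemma cabs_ge0 z : 0 <= cabs z.
Proof. by case: z => a b; exact: sqrtr_ge0. Qed.
Lemma cabs0 : cabs 0 = 0. Proof. exact: Normc.normc0. Qed.
Lemma cabs1 : cabs 1 = 1. Proof. exact: Normc.normc1. Qed.
Lemma cabsM z w : cabs (z * w) = cabs z * cabs w.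
Proof. exact: Normc.normcM. Qed.
Lemma cabsV z : cabs z^-1 = (cabs z)^-1. Proof. exact: Normc.normcV. Qed.
Lemma cabsX z n : cabs (z ^+ n) = cabs z ^+ n.
Proof. by elim: n => [|n ih]; rewrite ?expr0 ?cabs1// !exprS cabsM ih. Qed.
Lemma cabsN z : cabs (- z) = cabs z. Proof. exact: normcN. Qed.
Lemma cabsC z w : cabs (z - w) = cabs (w - z).
Proof. by rewrite -cabsN opprB. Qed.
Lemma cabsD z w : cabs (z + w) <= cabs z + cabs w.
Proof. exact: le_normcD. Qed.
Lemma cabsT u z w : cabs (z - w) <= cabs (z - u) + cabs (u - w).
Proof. by have := cabsD (z - u) (u - w); rewrite addrA subrK. Qed.
Lemma cabs_eq0 z : (cabs z == 0) = (z == 0).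
Proof.
by apply/eqP/eqP => [/Normc.eq0_normc //|->]; exact: cabs0.
Qed.
Lemma cabs_gt0 z : (0 < cabs z) = (z != 0).
Proof. by rewrite lt_neqAle cabs_ge0 andbT eq_sym cabs_eq0. Qed.
Lemma cabsr (x : R) : cabs x%:C = `|x|.
Proof. by rewrite /cabs /= expr0n /= addr0 sqrtr_sqr. Qed.
Lemma cabs_nat n : cabs n%:R = n%:R.
Proof. by rewrite -(rmorph_nat (real_complex R)) cabsr ger0_norm. Qed.
Lemma Re_le_cabs z : `|complex.Re z| <= cabs z.
Proof.
case: z => a b; rewrite /cabs /= -(sqrtr_sqr a); apply: ler_wsqrtr.
by rewrite lerDl sqr_ge0.
Qed.
Lemma Im_le_cabs z : `|complex.Im z| <= cabs z.
Proof.
case: z => a b; rewrite /cabs /= -(sqrtr_sqr b); apply: ler_wsqrtr.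
by rewrite lerDr sqr_ge0.
Qed.
Lemma cabs_le z : cabs z <= `|complex.Re z| + `|complex.Im z|.
Proof.
case: z => a b /=; have -> : a +i* b = a%:C + (b%:C * 'i) :> C.
  by simpc.
apply: (le_trans (cabsD _ _)); rewrite cabsM !cabsr.
suff -> : cabs 'i = 1 by rewrite mulr1.
by rewrite /cabs /= expr0n /= add0r expr1n sqrtr1.
Qed.

Lemma realCD (x y : R) : (x + y)%:C = x%:C + y%:C :> C.
Proof. exact: rmorphD. Qed.
Lemma realCN (x : R) : (- x)%:C = - x%:C :> C. Proof. exact: rmorphN. Qed.
Lemma realCB (x y : R) : (x - y)%:C = x%:C - y%:C :> C.
Proof. exact: rmorphB. Qed.
Lemma realCM (x y : R) : (x * y)%:C = x%:C * y%:C :> C.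
Proof. exact: rmorphM. Qed.
Lemma realCV (x : R) : (x^-1)%:C = (x%:C)^-1 :> C. Proof. exact: fmorphV. Qed.
Lemma realC_nat n : (n%:R)%:C = n%:R :> C. Proof. exact: rmorph_nat. Qed.
Lemma realC0 : (0 : R)%:C = 0 :> C. Proof. exact: rmorph0. Qed.
Lemma realC1 : (1 : R)%:C = 1 :> C. Proof. exact: rmorph1. Qed.
Definition realCE :=
  (realCB, realCD, realCN, realCM, realCV, realC0, realC1, realC_nat).

Lemma cvg_cabsP {T} (F : set_system T) {FF : Filter F} (f : T -> C) (l : C) :
  f @ F --> l <-> forall e : R, 0 < e -> \forall x \near F, cabs (f x - l) < e.
Proof.
split=> [/cvgrPdist_lt fl e e0|H].
  have /fl : 0 < e%:C :> R[i] by rewrite ltcR.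
  by apply: filterS => x /=; rewrite normcE_cabs ltcR cabsC.
apply/cvgrPdist_lt => e e0.
have [x ex] : exists x, e = x%:C by apply/complex_realP/gtr0_real.
rewrite ex ltcR in e0; apply: filterS (H _ e0) => t /=.
by rewrite ex normcE_cabs ltcR cabsC.
Qed.

Lemma nbhs_cabsP (z : C) (A : set C) :
  nbhs z A <-> exists2 d : R, 0 < d & forall w, cabs (w - z) < d -> A w.
Proof.
split.
  case/nbhs_ballP => e /= e0 H.
  have [x ex] : exists x, e = x%:C by apply/complex_realP/gtr0_real.
  rewrite ex ltcR in e0; exists x => // w wx; apply: H.
  by rewrite -ball_normE /= ex normcE_cabs ltcR cabsC.
case=> d d0 H; apply/nbhs_ballP; exists d%:C; first by rewrite /= ltcR.
by move=> w; rewrite -ball_normE /= normcE_cabs ltcR cabsC; exact: H.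
Qed.

Lemma cts_cabsP (f : C -> C) (z : C) :
  {for z, continuous f} <->
  forall e : R, 0 < e -> exists2 d : R, 0 < d &
    forall w, cabs (w - z) < d -> cabs (f w - f z) < e.
Proof.
split=> [H e e0|H].
  exact: ((nbhs_cabsP _ _).1 ((@cvg_cabsP _ (nbhs z) _ f (f z)).1 H _ e0)).
by apply/(@cvg_cabsP _ (nbhs z)) => e e0; apply/nbhs_cabsP; exact: H.
Qed.

Lemma continuous_cabs (z : C) : {for z, continuous cabs}.
Proof.
apply/(@cvgrPdist_lt _ _ _ (nbhs z)) => e e0; apply/nbhs_cabsP; exists e => // w we.
apply: le_lt_trans we; rewrite ler_norml; apply/andP; split.
  by have := cabsD (w - z) z; rewrite subrK; lra.
by have := cabsD (z - w) w; rewrite subrK cabsC; lra.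
Qed.

Lemma continuous_ReC (z : C) : {for z, continuous (@complex.Re R : C -> R)}.
Proof.
apply/(@cvgrPdist_lt _ _ _ (nbhs z)) => e e0; apply/nbhs_cabsP; exists e => // w we.
by apply: le_lt_trans we; rewrite cabsC -raddfB; exact: Re_le_cabs.
Qed.

Lemma continuous_ImC (z : C) : {for z, continuous (@complex.Im R : C -> R)}.
Proof.
apply/(@cvgrPdist_lt _ _ _ (nbhs z)) => e e0; apply/nbhs_cabsP; exists e => // w we.
by apply: le_lt_trans we; rewrite cabsC -raddfB; exact: Im_le_cabs.
Qed.

Lemma continuous_real_complex (x : R) :
  {for x, continuous (fun t : R => (t%:C : C))}.
Proof.
apply/(@cvg_cabsP _ (nbhs x)) => e e0; near=> t.
rewrite -rmorphB cabsr distrC.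
by near: t; exact: (@cvgr_dist_lt _ _ _ _ _ id x).
Unshelve. all: by end_near. Qed.

Lemma cvg_complex {T} (F : set_system T) {FF : Filter F} (f g : T -> R) a b :
  f @ F --> a -> g @ F --> b ->
  (fun t => (f t +i* g t) : C) @ F --> ((a +i* b) : C).
Proof.
move=> /cvgrPdist_lt fa /cvgrPdist_lt gb; apply/cvg_cabsP => e e0.
have e2 : 0 < e / 2 by rewrite divr_gt0.
apply: filterS2 (fa _ e2) (gb _ e2) => t /= h1 h2.
apply: (le_lt_trans (cabs_le _)) => /=.
by rewrite distrC (distrC (g t)); lra.
Qed.

End Modulus.
Arguments cabs : simpl never.

Section Continuity.
Variables (R : realType) (T : topologicalType).
Local Notation C := (R[i]^o).
Implicit Types (f g : T -> C) (z : T).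

Lemma cts_cst (c : C) z : {for z, continuous (fun _ : T => c)}.
Proof. exact: cvg_cst. Qed.

Lemma ctsD f g z : {for z, continuous f} -> {for z, continuous g} ->
  {for z, continuous (fun w => f w + g w)}.
Proof. by move=> fc gc; apply: cvgD; [exact: fc|exact: gc]. Qed.


Lemma ctsB f g z : {for z, continuous f} -> {for z, continuous g} ->
  {for z, continuous (fun w => f w - g w)}.
Proof. by move=> fc gc; apply: cvgB; [exact: fc|exact: gc]. Qed.

Lemma ctsM f g z : {for z, continuous f} -> {for z, continuous g} ->
  {for z, continuous (fun w => f w * g w)}.
Proof. by move=> fc gc; apply: cvgM; [exact: fc|exact: gc]. Qed.

Lemma ctsV f z : f z != 0 -> {for z, continuous f} ->
  {for z, continuous (fun w => (f w)^-1)}.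
Proof. by move=> fz fc; apply: cvgV => //; exact: fc. Qed.

Lemma cts_comp (U : topologicalType) (f : T -> U) (g : U -> C) z :
  {for z, continuous f} -> {for f z, continuous g} ->
  {for z, continuous (fun w => g (f w))}.
Proof. exact: continuous_comp. Qed.

Lemma cts_cabs f z : {for z, continuous f} ->
  {for z, continuous (fun w => cabs (f w))}.
Proof. move=> fc; exact: (continuous_comp fc (@continuous_cabs R _)). Qed.

Lemma cts_Re f z : {for z, continuous f} ->
  {for z, continuous (fun w => complex.Re (f w))}.
Proof. move=> fc; exact: (continuous_comp fc (@continuous_ReC R _)). Qed.

Lemma cts_Im f z : {for z, continuous f} ->
  {for z, continuous (fun w => complex.Im (f w))}.
Proof. move=> fc; exact: (continuous_comp fc (@continuous_ImC R _)). Qed.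

Lemma cts_cstR (c : R) z : {for z, continuous (fun _ : T => c)}.
Proof. exact: cvg_cst. Qed.

Lemma ctsMR (f g : T -> R) z : {for z, continuous f} ->
  {for z, continuous g} -> {for z, continuous (fun w => f w * g w)}.
Proof. by move=> fc gc; apply: cvgM; [exact: fc|exact: gc]. Qed.

Lemma ctsBR (f g : T -> R) z : {for z, continuous f} ->
  {for z, continuous g} -> {for z, continuous (fun w => f w - g w)}.
Proof. by move=> fc gc; apply: cvgB; [exact: fc|exact: gc]. Qed.

Lemma cts_real (f : T -> R) z : {for z, continuous f} ->
  {for z, continuous (fun w => ((f w)%:C : C))}.
Proof. by move=> fc; exact: (continuous_comp fc (@continuous_real_complex R _)). Qed.

End Continuity.

(** * Complex derivatives of functions of a real or complex variable *)

Section Derivative.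
Variable R : realType.
Local Notation C := (R[i]^o).

Section Generic.
Variables (D : topologicalType) (iota : D -> C).

(** Carathéodory's form of differentiability.  The embedding [iota] of the
    domain into the complex numbers covers functions of a complex variable and
    paths parametrised by a real one at the same time. *)
Definition has_deriv (f : D -> C) (z : D) (l : C) :=
  exists phi : D -> C, [/\ phi z = l, {for z, continuous phi} &
    \forall w \near z, f w = f z + phi w * (iota w - iota z)].

Hypothesis iota_cts : forall z, {for z, continuous iota}.

Lemma has_deriv_cts f z l : has_deriv f z l -> {for z, continuous f}.
Proof.
move=> [phi [_ pc H]].
have H' : \forall w \near z, f z + phi w * (iota w - iota z) = f w.
  by apply: filterS H => w ->.
suff : (fun w => f z + phi w * (iota w - iota z)) @ z --> f z.
  by move=> h; apply: cvg_trans h; exact: near_eq_cvg.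
have : (fun w => f z + phi w * (iota w - iota z)) @ z -->
   f z + phi z * (iota z - iota z).
  apply: cvgD; first exact: cvg_cst.
  apply: cvgM; first exact: pc.
  by apply: cvgB; [exact: iota_cts|exact: cvg_cst].
by rewrite subrr mulr0 addr0.
Qed.

Lemma has_deriv_near f g z l : (\forall w \near z, f w = g w) ->
  has_deriv f z l -> has_deriv g z l.
Proof.
move=> fg [phi [pl pc H]]; exists phi; split; [by []|by []|].
have fgz := nbhs_singleton fg.
by apply: filterS2 fg H => w <- ->; rewrite fgz.
Qed.

Lemma has_deriv_cst c z : has_deriv (fun _ => c) z 0.
Proof.
exists (fun _ => 0); split; [by []|exact: cvg_cst|].
by near=> w; rewrite mul0r addr0.
Unshelve. all: by end_near. Qed.

Lemma has_deriv_iota z : has_deriv iota z 1.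
Proof.
exists (fun _ => 1); split; [by []|exact: cvg_cst|].
by near=> w; rewrite mul1r addrC subrK.
Unshelve. all: by end_near. Qed.

Lemma has_derivD f g z l m : has_deriv f z l -> has_deriv g z m ->
  has_deriv (fun w => f w + g w) z (l + m).
Proof.
move=> [p [<- pc Hp]] [q [<- qc Hq]]; exists (fun w => p w + q w); split; [by []| |].
- by apply: cvgD; [exact: pc|exact: qc].
by apply: filterS2 Hp Hq => w -> ->; ring.
Qed.

Lemma has_derivM f g z l m : has_deriv f z l -> has_deriv g z m ->
  has_deriv (fun w => f w * g w) z (l * g z + f z * m).
Proof.
move=> df dg; have fc := has_deriv_cts df; have gc := has_deriv_cts dg.
case: df dg => [p [<- pc Hp]] [q [<- qc Hq]].
exists (fun w => p w * g w + f z * q w); split; [by []| |].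
- by apply: cvgD; apply: cvgM; [exact: pc|exact: gc|exact: cvg_cst|exact: qc].
by apply: filterS2 Hp Hq => w -> ->; ring.
Qed.

Lemma has_derivZ c f z l : has_deriv f z l ->
  has_deriv (fun w => c * f w) z (c * l).
Proof.
by move=> df; have := has_derivM (has_deriv_cst c z) df; rewrite mul0r add0r.
Qed.

Lemma has_derivN f z l : has_deriv f z l -> has_deriv (fun w => - f w) z (- l).
Proof.
move=> /(has_derivZ (-1)); rewrite mulN1r.
by apply: has_deriv_near; near=> w; rewrite mulN1r.
Unshelve. all: by end_near. Qed.

Lemma has_derivB f g z l m : has_deriv f z l -> has_deriv g z m ->
  has_deriv (fun w => f w - g w) z (l - m).
Proof. by move=> df /has_derivN; exact: has_derivD. Qed.

Lemma has_derivV f z l : f z != 0 -> has_deriv f z l ->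
  has_deriv (fun w => (f w)^-1) z (- l / (f z) ^+ 2).
Proof.
move=> fz0 df; have fc := has_deriv_cts df; case: df => [p [<- pc Hp]].
exists (fun w => - p w / (f w * f z)); split; [by rewrite expr2| |].
- apply: cvgM; first by apply: cvgN; exact: pc.
  apply: cvgV; first by rewrite mulf_neq0.
  by apply: cvgM; [exact: fc|exact: cvg_cst].
have fn0 : \forall w \near z, f w != 0.
  have fz0' : 0 < cabs (f z) by rewrite cabs_gt0.
  apply: filterS ((cvg_cabsP _ _).1 fc _ fz0') => w.
  by apply: contraTneq => ->; rewrite sub0r cabsN ltxx.
near=> w.
have fw0 : f w != 0 by near: w.
have E : f w = f z + p w * (iota w - iota z) by near: w.
have E' : p w * (iota w - iota z) = f w - f z by rewrite E addrAC subrr add0r.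
have -> : - p w / (f w * f z) * (iota w - iota z) = - (f w - f z) / (f w * f z).
  by rewrite -E'; ring.
by field; rewrite fw0 fz0.
Unshelve. all: by end_near. Qed.

Lemma has_deriv_comp (f : D -> C) (z : D) (l m : C) (g : C -> C)
    (psi : C -> C) :
  has_deriv f z l -> psi (f z) = m -> {for f z, continuous psi} ->
  (\forall w \near f z, g w = g (f z) + psi w * (w - f z)) ->
  has_deriv (fun w => g (f w)) z (m * l).
Proof.
move=> df <- qc Hq; have fc := has_deriv_cts df.
case: df => [p [<- pc Hp]].
exists (fun w => psi (f w) * p w); split; [by []| |].
- by apply: cvgM; [exact: (continuous_comp fc qc)|exact: pc].
have Hq' : \forall w \near z, g (f w) = g (f z) + psi (f w) * (f w - f z).
  exact: (fc _ Hq).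
apply: filterS2 Hp Hq' => w E ->; rewrite {2}E; ring.
Qed.

End Generic.

Definition rderiv (f : R -> C) (t : R) (l : C) :=
  @has_deriv _ (fun t : R => (t%:C : C)) f t l.
Definition cderiv (f : C -> C) (z l : C) := @has_deriv _ (@idfun C) f z l.

Lemma idC_cts (z : C) : {for z, continuous (@idfun C)}.
Proof. exact: cvg_id. Qed.

Lemma cderiv_cts f z l : cderiv f z l -> {for z, continuous f}.
Proof. exact: (has_deriv_cts (@idC_cts)). Qed.

Lemma rderiv_cts f z l : rderiv f z l -> {for z, continuous f}.
Proof. exact: (has_deriv_cts (@continuous_real_complex R)). Qed.

Lemma cderivM f g z l m : cderiv f z l -> cderiv g z m ->
  cderiv (fun w => f w * g w) z (l * g z + f z * m).
Proof. exact: (has_derivM (@idC_cts)). Qed.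

Lemma rderivM f g z l m : rderiv f z l -> rderiv g z m ->
  rderiv (fun w => f w * g w) z (l * g z + f z * m).
Proof. exact: (has_derivM (@continuous_real_complex R)). Qed.

Lemma rderivB f g z l m : rderiv f z l -> rderiv g z m ->
  rderiv (fun w => f w - g w) z (l - m).
Proof. exact: (has_derivB (@continuous_real_complex R)). Qed.

Lemma rderivZ c f z l : rderiv f z l -> rderiv (fun w => c * f w) z (c * l).
Proof. exact: (has_derivZ (@continuous_real_complex R)). Qed.

Lemma cderiv_id z : cderiv (fun w => w) z 1.
Proof. exact: has_deriv_iota. Qed.

Lemma cderiv_cst c z : cderiv (fun _ => c) z 0.
Proof. exact: has_deriv_cst. Qed.

Lemma cderivD f g z l m : cderiv f z l -> cderiv g z m ->
  cderiv (fun w => f w + g w) z (l + m).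
Proof. exact: has_derivD. Qed.

Lemma cderivN f z l : cderiv f z l -> cderiv (fun w => - f w) z (- l).
Proof. exact: (has_derivN (@idC_cts)). Qed.

Lemma cderivB f g z l m : cderiv f z l -> cderiv g z m ->
  cderiv (fun w => f w - g w) z (l - m).
Proof. exact: (has_derivB (@idC_cts)). Qed.

Lemma cderivZ c f z l : cderiv f z l -> cderiv (fun w => c * f w) z (c * l).
Proof. exact: (has_derivZ (@idC_cts)). Qed.

Lemma cderiv_subr a z : cderiv (fun w => w - a) z 1.
Proof. by have := cderivB (cderiv_id z) (cderiv_cst a z); rewrite subr0. Qed.

Lemma cderivV f z l : f z != 0 -> cderiv f z l ->
  cderiv (fun w => (f w)^-1) z (- l / (f z) ^+ 2).
Proof. exact: (has_derivV (@idC_cts)). Qed.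

Lemma cderiv_comp f g z l m : cderiv f z l -> cderiv g (f z) m ->
  cderiv (fun w => g (f w)) z (m * l).
Proof.
by move=> df [psi [h1 h2 h3]]; exact: (has_deriv_comp (@idC_cts) df h1 h2 h3).
Qed.

Lemma rderiv_comp f g z l m : rderiv f z l -> cderiv g (f z) m ->
  rderiv (fun w => g (f w)) z (m * l).
Proof.
move=> df [psi [h1 h2 h3]].
exact: (has_deriv_comp (@continuous_real_complex R) df h1 h2 h3).
Qed.

Lemma rderiv_affine f s c t l : rderiv f (s * t + c) l ->
  rderiv (fun t => f (s * t + c)) t (s%:C * l).
Proof.
move=> [p [<- pc Hp]].
have ac : {for t, continuous (fun t => s * t + c)}.
  apply: cvgD; last exact: cvg_cst.
  by apply: cvgM; [exact: cvg_cst|exact: cvg_id].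
exists (fun t => s%:C * p (s * t + c)); split; [by []| |].
- apply: cvgM; first exact: cvg_cst.
  exact: (continuous_comp ac pc).
have : \forall w \near t, f (s * w + c) = f (s * t + c) +
    p (s * w + c) * ((s * w + c)%:C - (s * t + c)%:C) by exact: (ac _ Hp).
by apply: filterS => w ->; rewrite !rmorphD !rmorphM /=; ring.
Qed.

Lemma cderivP (f : C -> C) (z l : C) :
  cderiv f z l <-> exists p : C -> C, [/\ p z = l, {for z, continuous p} &
    exists2 d : R, 0 < d &
      forall w, cabs (w - z) < d -> f w = f z + p w * (w - z)].
Proof.
split=> -[p [pl pc H]]; exists p; split; [by []|by []| |by []|by []|].
- exact: ((nbhs_cabsP _ _).1 H).
- exact: ((nbhs_cabsP _ _).2 H).
Qed.

Lemma cderiv_local (f g : C -> C) (z l : C) (d : R) : 0 < d ->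
  (forall w, cabs (w - z) < d -> f w = g w) -> cderiv f z l -> cderiv g z l.
Proof.
move=> d0 fg; apply: has_deriv_near; apply/nbhs_cabsP; by exists d.
Qed.

(** Both slope functions agree off [z], where they are continuous, so their
    values at [z] agree. *)
Lemma cderiv_unique (f : C -> C) (z l m : C) :
  cderiv f z l -> cderiv f z m -> l = m.
Proof.
move=> /cderivP[p [<- pc [d d0 Hp]]] /cderivP[q [<- qc [d' d'0 Hq]]].
have [//|ne] := eqVneq (p z) (q z).
have e0 : 0 < cabs (p z - q z) by rewrite cabs_gt0 subr_eq0.
have [d2 d20 H2] := (cts_cabsP _ _).1 (ctsB pc qc) _ e0.
pose h : R := Num.min d (Num.min d' d2) / 2.
have [h0 hd hd' hd2] : [/\ 0 < h, h < d, h < d' & h < d2].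
  have m0 : 0 < Num.min d (Num.min d' d2) by rewrite !lt_min d0 d'0 d20.
  have : Num.min d (Num.min d' d2) <= d by rewrite ge_min lexx.
  have : Num.min d (Num.min d' d2) <= d' by rewrite !ge_min lexx ?orbT.
  have : Num.min d (Num.min d' d2) <= d2 by rewrite !ge_min lexx ?orbT.
  by move=> a b c; split; rewrite /h; lra.
have hE : cabs (z + h%:C - z) = h by rewrite addrAC subrr add0r cabsr gtr0_norm.
have h0' : z + h%:C - z != 0 by rewrite -cabs_gt0 hE.
have := Hp (z + h%:C); rewrite hE => /(_ hd).
rewrite Hq ?hE// => /addrI/(mulIf h0') E.
by have := H2 (z + h%:C); rewrite hE E subrr sub0r cabsN ltxx => /(_ hd2).
Qed.

Lemma cderivX f z l n : cderiv f z l ->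
  cderiv (fun w => f w ^+ n.+1) z (n.+1%:R * f z ^+ n * l).
Proof.
move=> df; elim: n => [|n ih].
  by rewrite expr0 !mul1r.
have E : n.+2%:R * f z ^+ n.+1 * l =
    l * f z ^+ n.+1 + f z * (n.+1%:R * f z ^+ n * l).
  by rewrite -[n.+2%:R]natr1 exprS; ring.
rewrite E; exact: (cderivM df ih).
Qed.

(** The continuous slope function is the difference quotient, completed at [z]
    by the derivative. *)
Lemma derivable_cderiv (f : R[i] -> R[i]) (z : R[i]) :
  derivable (f : C -> C) z 1 <-> exists l, cderiv f z l.
Proof.
split.
  move=> /cvg_ex [l /= H]; exists l.
  exists (fun w => if w == z then l else (f w - f z) / (w - z)); split.
  - by rewrite eqxx.
  - apply/cts_cabsP => e e0 /=; rewrite eqxx.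
    have h := (cvg_cabsP _ _).1 H _ e0.
    have [d d0 Hd] := (nbhs_cabsP _ _).1 (h _).
    exists d => // w wd.
    case: eqP => [_|/eqP wz]; first by rewrite subrr cabs0.
    have := Hd (w - z); rewrite subr0 => /(_ wd).
    rewrite subr_eq0 => /(_ wz).
    by rewrite /GRing.scale /= mulr1 subrK mulrC.
  - near=> w; case: eqP => [->|/eqP wz]; first by rewrite subrr mulr0 addr0.
    by rewrite mulfVK ?subr_eq0// addrC subrK.
move=> [l [p [pl pc /nbhs_cabsP[d d0 Hp]]]].
apply/cvg_ex; exists l => /=.
apply/cvg_cabsP => e e0.
have [d' d'0 Hd] := (cts_cabsP _ _).1 pc _ e0.
apply/nbhs_cabsP; exists (Num.min d d'); first by rewrite lt_min d0.
move=> h; rewrite subr0 lt_min => /andP[hd hd'] h0.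
rewrite /GRing.scale /= mulr1 Hp; last by rewrite addrK.
have -> : h^-1 * (f z + p (h + z) * (h + z - z) - f z) = p (h + z).
  by field.
by rewrite -pl; apply: Hd; rewrite addrK.
Unshelve. all: by end_near. Qed.

End Derivative.

(** * Integrals over the unit interval of complex-valued functions *)

Section Integral.
Variable R : realType.
Local Notation C := (R[i]^o).
Implicit Types (phi Phi : R -> C) (t : R).

Lemma caratheodory_is_derive (f p : R -> R) (t : R) :
  {for t, continuous p} ->
  (\forall s \near t, f s = f t + p s * (s - t)) -> is_derive t 1 f (p t).
Proof.
move=> pc H.
have E : h^-1 *: (f (h *: 1 + t) - f t) @[h --> 0^'] --> p t.
  apply/cvgrPdist_lt => e e0.
  have /nbhs_ballP[d /= d0 Hd] := H.
  have [d' /= d'0 Hd'] := (nbhs_ballP _ _).1 ((@cvgrPdist_lt _ _ _ (nbhs t) _ _ _).1 pc _ e0).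
  apply/nbhs_ballP; exists (Num.min d d'); first by rewrite /= lt_min d0.
  move=> h /=; rewrite /ball /= sub0r normrN lt_min => /andP[hd hd'] h0.
  have hE : `|t - (h + t)| = `|h| by rewrite opprD addrC -addrA addNr addr0 normrN.
  rewrite /GRing.scale /= mulr1 Hd; last by rewrite /ball /= hE.
  have -> : h^-1 * (f t + p (h + t) * (h + t - t) - f t) = p (h + t).
    by field.
  by apply: Hd'; rewrite /ball /= hE.
by apply: DeriveDef; [apply/cvg_ex; exists (p t)|apply/cvg_lim].
Qed.

Lemma is_derive_caratheodory (f : R -> R) (t l : R) : is_derive t 1 f l ->
  exists p : R -> R, [/\ p t = l, {for t, continuous p} &
    forall s, f s = f t + p s * (s - t)].
Proof.
move=> [df Dl]; have H : h^-1 *: (f (h *: 1 + t) - f t) @[h --> 0^'] --> l.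
  by rewrite -Dl; exact: df.
exists (fun s => if s == t then l else (f s - f t) / (s - t)); split.
- by rewrite eqxx.
- apply/(@cvgrPdist_lt _ _ _ (nbhs t)) => e e0 /=; rewrite eqxx.
  have [d /= d0 Hd] := (nbhs_ballP _ _).1 ((cvgrPdist_lt _ _).1 H _ e0).
  apply/nbhs_ballP; exists d => // s /=; rewrite /ball /= => sd.
  case: eqP => [_|/eqP st]; first by rewrite subrr normr0.
  have /= := Hd (s - t); rewrite /ball /= sub0r opprB => /(_ sd).
  rewrite subr_eq0 => /(_ st).
  by rewrite /GRing.scale /= mulr1 subrK mulrC.
- move=> s; case: eqP => [->|/eqP st]; first by rewrite subrr mulr0 addr0.
  by rewrite mulfVK ?subr_eq0// addrC subrK.
Qed.

(** The factor [k] is there for the mean value theorem: choosing it as the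
    conjugate of an increment turns that increment into a real number. *)
Lemma rderiv_Re (k : C) Phi t l : rderiv Phi t l ->
  is_derive t 1 (fun s => complex.Re (k * Phi s)) (complex.Re (k * l)).
Proof.
move=> [p [<- pc Hp]].
apply: (@caratheodory_is_derive _ (fun s => complex.Re (k * p s))).
  by apply: cts_Re; apply: ctsM; [exact: cts_cst|exact: pc].
apply: filterS Hp => s ->; rewrite -rmorphB mulrDr raddfD /=; congr (_ + _).
rewrite mulrA; case: (k * p s) => a b /=; simpc => /=; ring.
Qed.

Lemma rderiv_complex (f g : R -> R) t a b :
  is_derive t 1 f a -> is_derive t 1 g b ->
  rderiv (fun s => (f s +i* g s) : C) t (a +i* b).
Proof.
move=> /is_derive_caratheodory[p [<- pc Hp]] /is_derive_caratheodory[q [<- qc Hq]].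
exists (fun s => (p s +i* q s) : C); split; first by [].
  exact: (cvg_complex pc qc).
near=> s; rewrite (Hp s) (Hq s) -rmorphB; simpc.
by congr (_ +i* _); ring.
Unshelve. all: by end_near. Qed.

(** The integral starts at -1, so that both endpoints of the unit interval are
    interior points and the derivative is two-sided there. *)
Lemma real_primitive (f : R -> R) : (forall t, {for t, continuous f}) ->
  exists F : R -> R, forall t, 0 <= t <= 1 -> is_derive t 1 F (f t).
Proof.
move=> fc; eexists => t /andP[t0 t1].
have [||||d e] := @continuous_FTC1_closed R f (-1) t 2.
- lra.
- apply: continuous_compact_integrable; first exact: segment_compact.
  by apply: continuous_subspaceT => x; exact: fc.
- lra.
- exact: fc.
by apply: DeriveDef; [exact: d|rewrite -derive1E; exact: e].
Qed.

(** Composing with the retraction onto the unit interval makes continuous on the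
    whole line a function that is only known to be continuous on this interval. *)
Definition clamp (t : R) : R := Num.max 0 (Num.min t 1).

Lemma clamp01 t : 0 <= clamp t <= 1.
Proof. by rewrite /clamp le_max lexx /= ge_max ler01 ge_min lexx orbT. Qed.

Lemma clamp_id t : 0 <= t <= 1 -> clamp t = t.
Proof. by move=> /andP[t0 t1]; rewrite /clamp min_l// max_r. Qed.

Lemma clamp_cts t : {for t, continuous clamp}.
Proof.
apply: (@continuous_max R R (fun=> 0) (fun t => Num.min t 1)).
  exact: cvg_cst.
apply: (@continuous_min R R (fun t => t) (fun=> 1)); first exact: cvg_id.
exact: cvg_cst.
Qed.

Lemma complex_primitive phi : (forall t, 0 <= t <= 1 -> {for t, continuous phi}) ->
  exists Phi, forall t, 0 <= t <= 1 -> rderiv Phi t (phi t).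
Proof.
move=> pc.
have pc' t : {for t, continuous (fun t => phi (clamp t))}.
  apply: (cts_comp (f := clamp)); first exact: clamp_cts.
  exact: (pc _ (clamp01 t)).
have [F HF] := @real_primitive (fun t => complex.Re (phi (clamp t)))
  (fun t => cts_Re (pc' t)).
have [G HG] := @real_primitive (fun t => complex.Im (phi (clamp t)))
  (fun t => cts_Im (pc' t)).
exists (fun s => F s +i* G s) => t t01.
have := rderiv_complex (HF _ t01) (HG _ t01); rewrite (clamp_id t01).
by case: (phi t).
Qed.

(** With [D] the increment of [Phi], the real mean value theorem applies to the
    real part of [conj D * Phi], whose increment is [|D| ^ 2]. *)
Lemma rderiv_mvt Phi phi (M : R) :
  (forall t, 0 <= t <= 1 -> rderiv Phi t (phi t)) ->
  (forall t, 0 <= t <= 1 -> cabs (phi t) <= M) ->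
  cabs (Phi 1 - Phi 0) <= M.
Proof.
move=> dP pM; set D := Phi 1 - Phi 0.
have M0 : 0 <= M by apply: le_trans (cabs_ge0 _) (pM 0 _); rewrite lexx ler01.
have [->|D0] := eqVneq D 0; first by rewrite cabs0.
pose k : C := D^*.
have [||c cI E] := @MVT R (fun s => complex.Re (k * Phi s))
   (fun s => complex.Re (k * phi s)) 0 1 ltr01.
- by move=> x; rewrite in_itv /= => /andP[x0 x1]; apply/rderiv_Re/dP; lra.
- apply: derivable_within_continuous => x; rewrite in_itv /= => x01.
  by have [] := rderiv_Re k (dP _ x01).
have c01 : 0 <= c <= 1 by move: cI; rewrite in_itv /=; lra.
have kD : cabs k = cabs D.
  by rewrite /k; case: (D) => a b; rewrite /cabs /= sqrrN.
have : cabs D * cabs D <= cabs D * M.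
  have -> : cabs D * cabs D = complex.Re (k * Phi 1) - complex.Re (k * Phi 0).
    rewrite -raddfB -mulrBr -/D /k; case: (D) => a b.
    rewrite /cabs /= -expr2 sqr_sqrtr ?addr_ge0 ?sqr_ge0//; simpc => /=; ring.
  rewrite E subr0 mulr1; apply: le_trans (ler_norm _) _.
  apply: le_trans (Re_le_cabs _) _; rewrite cabsM kD.
  by rewrite ler_wpM2l ?cabs_ge0 ?pM.
by rewrite ler_pM2l// cabs_gt0.
Qed.

(** The increment of any primitive; [integral01E] says that it does not depend on
    the choice, so that the properties of the integral reduce to the calculus of
    derivatives. *)
Definition integral01 phi : C :=
  xget 0 [set v | exists Phi, (forall t, 0 <= t <= 1 -> rderiv Phi t (phi t))
     /\ v = Phi 1 - Phi 0].

Lemma integral01E phi Phi : (forall t, 0 <= t <= 1 -> rderiv Phi t (phi t)) ->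
  integral01 phi = Phi 1 - Phi 0.
Proof.
move=> dP; rewrite /integral01.
case: xgetP => [v _ [Psi [dQ ->]]|/(_ (Phi 1 - Phi 0))]; last first.
  by case; exists Phi.
have : cabs ((Psi 1 - Phi 1) - (Psi 0 - Phi 0)) <= 0.
  apply: (@rderiv_mvt (fun t => Psi t - Phi t) (fun t => phi t - phi t)).
    by move=> t t01; apply: rderivB; [exact: dQ|exact: dP].
  by move=> t _; rewrite subrr cabs0.
move=> h; have /eqP : cabs ((Psi 1 - Phi 1) - (Psi 0 - Phi 0)) == 0.
  by rewrite eq_le h cabs_ge0.
move/eqP; rewrite cabs_eq0 => /eqP E.
by apply/eqP; rewrite -subr_eq0 -E; apply/eqP; ring.
Qed.

Definition cts01 phi := forall t, 0 <= t <= 1 -> {for t, continuous phi}.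

Lemma integral01_le phi (M : R) : cts01 phi ->
  (forall t, 0 <= t <= 1 -> cabs (phi t) <= M) -> cabs (integral01 phi) <= M.
Proof.
move=> /complex_primitive[Phi dP] pM; rewrite (integral01E dP).
exact: rderiv_mvt dP pM.
Qed.

Lemma eq_integral01 phi psi : cts01 phi ->
  (forall t, 0 <= t <= 1 -> phi t = psi t) -> integral01 phi = integral01 psi.
Proof.
move=> /complex_primitive[Phi dP] E; rewrite (integral01E dP).
by rewrite (@integral01E psi Phi)// => t t01; rewrite -E//; exact: dP.
Qed.

Lemma integral01D phi psi : cts01 phi -> cts01 psi ->
  integral01 (fun t => phi t + psi t) = integral01 phi + integral01 psi.
Proof.
move=> /complex_primitive[Phi dP] /complex_primitive[Psi dQ].
rewrite (integral01E dP) (integral01E dQ).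
rewrite (@integral01E _ (fun t => Phi t + Psi t)); first by ring.
by move=> t t01; apply: has_derivD; [exact: dP|exact: dQ].
Qed.

Lemma integral01Z c phi : cts01 phi ->
  integral01 (fun t => c * phi t) = c * integral01 phi.
Proof.
move=> /complex_primitive[Phi dP]; rewrite (integral01E dP).
rewrite (@integral01E _ (fun t => c * Phi t)); first by ring.
by move=> t t01; apply: rderivZ; exact: dP.
Qed.

Lemma integral01B phi psi : cts01 phi -> cts01 psi ->
  integral01 (fun t => phi t - psi t) = integral01 phi - integral01 psi.
Proof.
move=> /complex_primitive[Phi dP] /complex_primitive[Psi dQ].
rewrite (integral01E dP) (integral01E dQ).
rewrite (@integral01E _ (fun t => Phi t - Psi t)); first by ring.
by move=> t t01; apply: rderivB; [exact: dP|exact: dQ].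
Qed.

Lemma integral01_cst c : integral01 (fun=> c) = c.
Proof.
rewrite (@integral01E _ (fun t => c * t%:C)).
  by rewrite rmorph0 rmorph1 mulr0 subr0 mulr1.
move=> t _; rewrite -[X in rderiv _ _ X]mulr1.
by apply: rderivZ; exact: has_deriv_iota.
Qed.

(** Joint continuity is uniform in the first variable, because the unit interval
    is compact. *)
Lemma integral01_cts (F : R -> C -> C) (a : C) :
  (forall t, 0 <= t <= 1 ->
     {for (t, a), continuous (fun x : R * C => F x.1 x.2)}) ->
  (exists2 d : R, 0 < d & forall b, cabs (b - a) < d -> cts01 (F ^~ b)) ->
  {for a, continuous (fun b => integral01 (F ^~ b))}.
Proof.
move=> Fc [d d0 Fb]; apply/cts_cabsP => e e0.
have e2 : 0 < e / 2 by rewrite divr_gt0.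
have /compact_near_coveringP cov := @segment_compact R 0 1.
pose P (b : C) (t : R) : Prop := cabs (F t b - F t a) < e / 2.
have /nbhs_cabsP[d' d'0 Hd] : \forall b \near nbhs a,
    `[0, 1]%classic `<=` P b.
  apply: (cov C (nbhs a) P) => t; rewrite /= in_itv /= => t01.
  have e4 : 0 < e / 4 by rewrite divr_gt0.
  have ta : {for t, continuous (F ^~ a)}.
    by apply: Fb t01; rewrite subrr cabs0.
  have h1 := (@cvg_cabsP R _ (nbhs (t, a)) _ _ _).1 (Fc _ t01) _ e4.
  have h2 := (@cvg_cabsP R _ (nbhs t) _ _ _).1 ta _ e4.
  case: h1 => -[A B] /= [tA aB] AB.
  exists (A `&` [set s | cabs (F s a - F t a) < e / 4], B) => /=.
    by split; [exact: (filterI tA (h2 _))|exact: aB].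
  case=> s b /= [[As hs] Bb].
  have := AB (s, b) (conj As Bb) => /= hb.
  apply: le_lt_trans (cabsT (F t a) _ _) _; rewrite (cabsC (F t a)).
  by move: hs hb => /=; lra.
exists (Num.min d d'); first by rewrite lt_min d0.
move=> b; rewrite lt_min => /andP[bd bd'].
have aa : cts01 (F ^~ a) by apply: Fb; rewrite subrr cabs0.
rewrite -(integral01B (Fb _ bd) aa).
apply: (@le_lt_trans _ _ (e / 2)); last by lra.
apply: integral01_le => [t t01|t t01].
  by apply: ctsB; [exact: (Fb _ bd)|exact: aa].
by apply/ltW; apply: (Hd _ bd'); rewrite /= in_itv.
Qed.

End Integral.

(** * Integrals along segments *)

Section Segments.
Variable R : realType.
Local Notation C := (R[i]^o).
Implicit Types (f g : C -> C) (a b c z w : C) (s t : R).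

Definition seg a b t : C := a + t%:C * (b - a).

Lemma seg0 a b : seg a b 0 = a.
Proof. by rewrite /seg rmorph0 mul0r addr0. Qed.
Lemma seg1 a b : seg a b 1 = b.
Proof. by rewrite /seg rmorph1 mul1r addrC subrK. Qed.
Lemma seg_cts a b t : {for t, continuous (seg a b)}.
Proof.
apply: ctsD; first exact: cts_cst.
by apply: ctsM; [exact: continuous_real_complex|exact: cts_cst].
Qed.

Lemma rderiv_seg a b t : rderiv (seg a b) t (b - a).
Proof.
have h := rderivM (has_deriv_iota _ t) (has_deriv_cst _ (b - a) t).
rewrite mul1r mulr0 addr0 in h.
by have := has_derivD (has_deriv_cst _ a t) h; rewrite add0r.
Qed.

Definition cts_seg f a b :=
  forall t, 0 <= t <= 1 -> {for seg a b t, continuous f}.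

Lemma cts_seg01 f a b : cts_seg f a b -> cts01 (fun t => f (seg a b t)).
Proof.
move=> fc t t01; apply: (cts_comp (f := seg a b)); first exact: seg_cts.
exact: fc.
Qed.

Definition seg_int f a b : C := (b - a) * integral01 (fun t => f (seg a b t)).

Lemma seg_int_primitive f a b : cts_seg f a b ->
  exists Phi, forall t, 0 <= t <= 1 -> rderiv Phi t ((b - a) * f (seg a b t)).
Proof.
move=> /cts_seg01/complex_primitive[Phi dP].
by exists (fun t => (b - a) * Phi t) => t t01; apply: rderivZ; exact: dP.
Qed.

Lemma seg_intE f a b Phi : cts_seg f a b ->
  (forall t, 0 <= t <= 1 -> rderiv Phi t ((b - a) * f (seg a b t))) ->
  seg_int f a b = Phi 1 - Phi 0.
Proof.
move=> fc dP; rewrite /seg_int -(integral01Z _ (cts_seg01 fc)).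
exact: integral01E.
Qed.

Lemma seg_int_le f a b M : cts_seg f a b ->
  (forall t, 0 <= t <= 1 -> cabs (f (seg a b t)) <= M) ->
  cabs (seg_int f a b) <= M * cabs (b - a).
Proof.
move=> fc fM; rewrite /seg_int cabsM mulrC ler_wpM2r ?cabs_ge0//.
by apply: integral01_le fM; exact: cts_seg01.
Qed.

Lemma seg_rev a b t : seg b a t = seg a b (-1 * t + 1).
Proof. by rewrite /seg rmorphD rmorphM rmorphN rmorph1 /=; ring. Qed.

Lemma seg_sub a b s t : seg a (seg a b s) t = seg a b (s * t + 0).
Proof. by rewrite addr0 /seg rmorphM /=; ring. Qed.

Lemma seg_sub' a b s t : seg (seg a b s) b t = seg a b ((1 - s) * t + s).
Proof. by rewrite /seg rmorphD rmorphM rmorphB rmorph1 /=; ring. Qed.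

Lemma cts_seg_rev f a b : cts_seg f a b -> cts_seg f b a.
Proof. by move=> fc t t01; rewrite seg_rev; apply: fc; lra. Qed.

Lemma cts_seg_sub f a b s : 0 <= s <= 1 -> cts_seg f a b ->
  cts_seg f a (seg a b s).
Proof. by move=> s01 fc t t01; rewrite seg_sub; apply: fc; nra. Qed.

Lemma cts_seg_sub' f a b s : 0 <= s <= 1 -> cts_seg f a b ->
  cts_seg f (seg a b s) b.
Proof. by move=> s01 fc t t01; rewrite seg_sub'; apply: fc; nra. Qed.

(** A primitive along the reversed segment is obtained by the substitution
    [1 - t]. *)
Lemma seg_int_rev f a b : cts_seg f a b -> seg_int f b a = - seg_int f a b.
Proof.
move=> fc; have [Phi dP] := seg_int_primitive fc; rewrite (seg_intE fc dP).
rewrite (@seg_intE f b a (fun t => Phi (-1 * t + 1))).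
- by rewrite mulr0 add0r mulr1 addNr opprB.
- exact: cts_seg_rev.
move=> t t01; have t01' : 0 <= -1 * t + 1 <= 1 by lra.
have -> : (a - b) * f (seg b a t) = (-1)%:C * ((b - a) * f (seg a b (-1 * t + 1))).
  by rewrite -seg_rev rmorphN rmorph1 mulrA mulN1r opprB.
by apply: rderiv_affine; exact: dP.
Qed.

(** Restricted to a part of the segment and rescaled, a primitive is a primitive
    along this part. *)
Lemma seg_int_split f a b s : 0 <= s <= 1 -> cts_seg f a b ->
  seg_int f a b = seg_int f a (seg a b s) + seg_int f (seg a b s) b.
Proof.
move=> s01 fc; have [Phi dP] := seg_int_primitive fc; rewrite (seg_intE fc dP).
rewrite (@seg_intE f a (seg a b s) (fun t => Phi (s * t + 0))).
- rewrite (@seg_intE f (seg a b s) b (fun t => Phi ((1 - s) * t + s))).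
  + by rewrite !mulr0 !mulr1 !addr0 add0r subrK; ring.
  + exact: cts_seg_sub'.
  move=> t t01; have t01' : 0 <= (1 - s) * t + s <= 1 by nra.
  have -> : (b - seg a b s) * f (seg (seg a b s) b t) =
      (1 - s)%:C * ((b - a) * f (seg a b ((1 - s) * t + s))).
    by rewrite -seg_sub' rmorphB rmorph1 /seg; ring.
  by apply: rderiv_affine; exact: dP.
- exact: cts_seg_sub.
move=> t t01; have t01' : 0 <= s * t + 0 <= 1 by nra.
have -> : (seg a b s - a) * f (seg a (seg a b s) t) =
    s%:C * ((b - a) * f (seg a b (s * t + 0))).
  by rewrite -seg_sub /seg; ring.
by apply: rderiv_affine; exact: dP.
Qed.

Lemma seg_intB f g a b : cts_seg f a b -> cts_seg g a b ->
  seg_int (fun z => f z - g z) a b = seg_int f a b - seg_int g a b.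
Proof.
move=> fc gc; rewrite /seg_int (integral01B (cts_seg01 fc) (cts_seg01 gc)).
by rewrite mulrBr.
Qed.

Lemma seg_int_deriv F f a b : cts_seg f a b ->
  (forall t, 0 <= t <= 1 -> cderiv F (seg a b t) (f (seg a b t))) ->
  seg_int f a b = F b - F a.
Proof.
move=> fc dF; rewrite (@seg_intE f a b (fun t => F (seg a b t)))//.
  by rewrite seg0 seg1.
move=> t t01; rewrite mulrC; apply: rderiv_comp (dF _ t01).
exact: rderiv_seg.
Qed.

Lemma seg_mvt F f a b M :
  (forall t, 0 <= t <= 1 -> cderiv F (seg a b t) (f (seg a b t))) ->
  (forall t, 0 <= t <= 1 -> cabs (f (seg a b t)) <= M) ->
  cabs (F b - F a) <= M * cabs (b - a).
Proof.
move=> dF fM.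
have := @rderiv_mvt R (fun t => F (seg a b t)) (fun t => f (seg a b t) * (b - a))
  (M * cabs (b - a)).
rewrite seg0 seg1; apply.
  by move=> t t01; apply: rderiv_comp (dF _ t01); exact: rderiv_seg.
by move=> t t01; rewrite cabsM ler_wpM2r ?cabs_ge0 ?fM.
Qed.

End Segments.

(** * Triangles and their subdivision *)

Section Goursat.
Variable R : realType.
Local Notation C := (R[i]^o).
Implicit Types (f g : C -> C) (a b c z w : C) (s t : R).

Definition hull a b c : set C := [set z | exists x y w : R,
  [/\ 0 <= x, 0 <= y, 0 <= w, x + y + w = 1 &
      z = x%:C * a + y%:C * b + w%:C * c]].

Definition tri_int f a b c : C :=
  seg_int f a b + seg_int f b c + seg_int f c a.

Lemma hull_rot a b c : hull a b c = hull b c a.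
Proof.
apply/seteqP; split=> z [x [y [w [x0 y0 w0 e ->]]]].
  by exists y, w, x; split=> //; [rewrite -e; ring|ring].
by exists w, x, y; split=> //; [rewrite -e; ring|ring].
Qed.

Lemma hull_seg a b c t : 0 <= t <= 1 -> hull a b c (seg a b t).
Proof.
move=> t01; exists (1 - t), t, 0; split; [lra|lra|lra|lra|].
by rewrite /seg rmorphB rmorph1 rmorph0; ring.
Qed.

Lemma hull_vertex a b c : hull a b c a.
Proof. by have := @hull_seg a b c 0; rewrite seg0; apply; lra. Qed.

Lemma hull_dist a b c d z : hull a b c z -> cabs (b - a) <= d ->
  cabs (c - a) <= d -> cabs (z - a) <= d.
Proof.
move=> [x [y [w [x0 y0 w0 e ->]]]] bd cd.
have -> : x%:C * a + y%:C * b + w%:C * c - a = y%:C * (b - a) + w%:C * (c - a).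
  have -> : x = 1 - y - w by lra.
  by rewrite !rmorphB rmorph1; ring.
apply: le_trans (cabsD _ _) _; rewrite !cabsM !cabsr !ger0_norm//.
have := cabs_ge0 (b - a); have := cabs_ge0 (c - a); nra.
Qed.

(** Every point of a triangle lies on a segment from the vertex [a] to a point of
    the opposite side; this presents the triangle as a continuous image of a
    square. *)
Lemma hull_segP a b c z : hull a b c z <->
  exists s t, [/\ 0 <= s <= 1, 0 <= t <= 1 & z = seg a (seg b c t) s].
Proof.
split; last first.
  move=> [s [t [s01 t01 ->]]].
  exists (1 - s), (s * (1 - t)), (s * t); split; [nra|nra|nra|lra|].
  by rewrite /seg !realCE; ring.
move=> [x [y [w [x0 y0 w0 e ->]]]].
have [s0|s0] := eqVneq (y + w) 0.
  exists 0, 0; split; [by rewrite lexx ler01|by rewrite lexx ler01|].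
  have [-> ->] : y = 0 /\ w = 0 by split; lra.
  have -> : x = 1 by lra.
  by rewrite /seg !realCE; ring.
have s0' : 0 < y + w by rewrite lt_neqAle eq_sym s0 /=; lra.
exists (y + w), (w / (y + w)); split; first lra.
  by rewrite divr_ge0 ?ler_pdivrMr//; lra.
have -> : x = 1 - (y + w) by lra.
have s0C : y%:C + w%:C != 0 :> C by rewrite -realCD fmorph_eq0.
by rewrite /seg !realCE; field.
Qed.

Lemma hull_compact a b c : compact (hull a b c).
Proof.
pose h (x : R * R) : C := a + (x.1)%:C * ((b + (x.2)%:C * (c - b)) - a).
have fstc x : {for x, continuous (fun x : R * R => (x.1)%:C : C)}.
  exact: (@cts_real R _ (fun x : R * R => x.1) _ cvg_fst).
have sndc x : {for x, continuous (fun x : R * R => (x.2)%:C : C)}.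
  exact: (@cts_real R _ (fun x : R * R => x.2) _ cvg_snd).
have hc x : {for x, continuous h}.
  apply: ctsD; first exact: cts_cst.
  apply: ctsM; first exact: fstc.
  apply: ctsB; last exact: cts_cst.
  apply: ctsD; first exact: cts_cst.
  by apply: ctsM; [exact: sndc|exact: cts_cst].
have -> : hull a b c = h @` (`[0, 1]%classic `*` `[0, 1]%classic).
  apply/seteqP; split=> [z /hull_segP[s [t [s01 t01 ->]]]|_ [[s t] [/= s01 t01] <-]].
    by exists (s, t) => //; split; rewrite /= in_itv.
  by apply/hull_segP; exists s, t; rewrite !in_itv /= in s01 t01.
apply: continuous_compact; last first.
  by apply: compact_setX; exact: segment_compact.
by apply: continuous_subspaceT => x; exact: hc.
Qed.

Definition mid a b : C := seg a b (1 / 2).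

Lemma midE a b : mid a b = (a + b) / 2.
Proof. by rewrite /mid /seg !realCE; field. Qed.

Definition subtri (T U : C * C * C) :=
  let: (a, b, c) := T in
  U = (a, mid a b, mid c a) \/ U = (mid a b, b, mid b c) \/
  U = (mid c a, mid b c, c) \/ U = (mid a b, mid b c, mid c a).

Definition thull (T : C * C * C) := let: (a, b, c) := T in hull a b c.
Definition tint f (T : C * C * C) := let: (a, b, c) := T in tri_int f a b c.
Definition tsmall (d : R) (T : C * C * C) := let: (a, b, c) := T in
  [/\ cabs (b - a) <= d, cabs (c - b) <= d & cabs (a - c) <= d].

Lemma subtri_hull T U : subtri T U -> thull U `<=` thull T.
Proof.
case: T => -[a b] c /= H z.
case: H => [|[|[|]]] -> [x [y [w [x0 y0 w0 e ->]]]]; rewrite !midE.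
- exists (x + (y / 2 + w / 2)), (y / 2), (w / 2); split; [lra|lra|lra|lra|].
  by rewrite !realCE; field.
- exists (x / 2), (y + (x / 2 + w / 2)), (w / 2); split; [lra|lra|lra|lra|].
  by rewrite !realCE; field.
- exists (x / 2), (y / 2), (w + (x / 2 + y / 2)); split; [lra|lra|lra|lra|].
  by rewrite !realCE; field.
- exists (x / 2 + w / 2), (x / 2 + y / 2), (y / 2 + w / 2).
  split; [lra|lra|lra|lra|].
  by rewrite !realCE; field.
Qed.

Lemma subtri_small d T U : subtri T U -> tsmall d T -> tsmall (d / 2) U.
Proof.
have half x y : cabs x <= d -> y = x / 2 \/ y = - x / 2 -> cabs y <= d / 2.
  move=> xd [|] ->; rewrite !cabsM ?cabsN cabsV cabs_nat; lra.
case: T => -[a b] c /= H [ab bc ca].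
case: H => [|[|[|]]] ->; rewrite /tsmall !midE.
- split; [apply: (half _ _ ab)|apply: (half _ _ bc)|apply: (half _ _ ca)].
  + by left; field.
  + by left; field.
  + by left; field.
- split; [apply: (half _ _ ab)|apply: (half _ _ bc)|apply: (half _ _ ca)].
  + by left; field.
  + by left; field.
  + by left; field.
- split; [apply: (half _ _ ab)|apply: (half _ _ bc)|apply: (half _ _ ca)].
  + by left; field.
  + by left; field.
  + by left; field.
- split; [apply: (half _ _ ca)|apply: (half _ _ ab)|apply: (half _ _ bc)].
  + by right; field.
  + by right; field.
  + by right; field.
Qed.

Definition cts_hull f T := forall z, thull T z -> {for z, continuous f}.

Lemma cts_hull_seg f a b c : cts_hull f (a, b, c) ->
  [/\ cts_seg f a b, cts_seg f b c & cts_seg f c a].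
Proof.
move=> fc; split=> t t01; apply: fc => /=; first exact: hull_seg.
  by rewrite hull_rot; exact: hull_seg.
by rewrite 2!hull_rot; exact: hull_seg.
Qed.

Lemma seg_in_hull a b c x y t : 0 <= t <= 1 -> hull a b c x -> hull a b c y ->
  hull a b c (seg x y t).
Proof.
move=> t01 [x1 [x2 [x3 [x10 x20 x30 xe ->]]]] [y1 [y2 [y3 [y10 y20 y30 ye ->]]]].
exists ((1 - t) * x1 + t * y1), ((1 - t) * x2 + t * y2), ((1 - t) * x3 + t * y3).
split; [nra|nra|nra| |].
  have -> : (1 - t) * x1 + t * y1 + ((1 - t) * x2 + t * y2) +
    ((1 - t) * x3 + t * y3) = (1 - t) * (x1 + x2 + x3) + t * (y1 + y2 + y3).
    by ring.
  by rewrite xe ye; ring.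
by rewrite /seg !realCE; ring.
Qed.

(** The inner sides are run through twice, in opposite directions. *)
Lemma tri_int_split f a b c : cts_hull f (a, b, c) ->
  tri_int f a b c = tri_int f a (mid a b) (mid c a) +
    tri_int f (mid a b) b (mid b c) + tri_int f (mid c a) (mid b c) c +
    tri_int f (mid a b) (mid b c) (mid c a).
Proof.
move=> fc; have [fab fbc fca] := cts_hull_seg fc.
have h01 : 0 <= (1 / 2 : R) <= 1 by lra.
have hab : hull a b c (mid a b) by exact: hull_seg.
have hbc : hull a b c (mid b c) by rewrite hull_rot; exact: hull_seg.
have hca : hull a b c (mid c a) by rewrite 2!hull_rot; exact: hull_seg.
have fin x y : hull a b c x -> hull a b c y -> cts_seg f x y.
  by move=> hx hy t t01; apply: fc; exact: seg_in_hull.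
rewrite /tri_int (seg_int_split h01 fab) (seg_int_split h01 fbc).
rewrite (seg_int_split h01 fca) -/(mid a b) -/(mid b c) -/(mid c a).
rewrite (seg_int_rev (fin _ _ hab hca)) (seg_int_rev (fin _ _ hab hbc)).
rewrite (seg_int_rev (fin _ _ hbc hca)); ring.
Qed.

Lemma subtri_large f T : cts_hull f T ->
  exists U, subtri T U /\ cabs (tint f T) <= 4 * cabs (tint f U).
Proof.
case: T => -[a b] c fc; set M := cabs _.
pose U1 := (a, mid a b, mid c a); pose U2 := (mid a b, b, mid b c).
pose U3 := (mid c a, mid b c, c); pose U4 := (mid a b, mid b c, mid c a).
have E : tint f (a, b, c) = tint f U1 + tint f U2 + tint f U3 + tint f U4.
  exact: tri_int_split.
have : M <= cabs (tint f U1) + cabs (tint f U2) + cabs (tint f U3) + cabs (tint f U4).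
  rewrite /M E; apply: le_trans (cabsD _ _) _; rewrite lerD2r.
  by apply: le_trans (cabsD _ _) _; rewrite lerD2r; exact: cabsD.
have [h1|h1] := leP M (4 * cabs (tint f U1)).
  by exists U1; split=> //; left.
have [h2|h2] := leP M (4 * cabs (tint f U2)).
  by exists U2; split=> //; right; left.
have [h3|h3] := leP M (4 * cabs (tint f U3)).
  by exists U3; split=> //; right; right; left.
have [h4|h4] := leP M (4 * cabs (tint f U4)).
  by exists U4; split=> //; right; right; right.
lra.
Qed.

(** An affine function has a primitive on the whole plane. *)
Lemma tri_int_affine (al l z0 : C) a b c :
  tri_int (fun w => al + l * (w - z0)) a b c = 0.
Proof.
pose F w : C := al * w + l * ((w - z0) ^+ 2) / 2.
have dF w : cderiv F w (al + l * (w - z0)).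
  have := cderivD (cderivZ al (cderiv_id w)) (cderivZ (l / 2)
    (cderivX 1 (cderivB (cderiv_id w) (cderiv_cst z0 w)))).
  rewrite subr0 expr1 !mulr1.
  have -> : l / 2 * (2%:R * (w - z0)) = l * (w - z0) by field.
  apply: (@cderiv_local _ _ _ _ _ 1) => // x _.
  by rewrite /F mulrAC.
have fc x y : cts_seg (fun w => al + l * (w - z0)) x y.
  move=> t _; apply: ctsD; first exact: cts_cst.
  apply: ctsM; first exact: cts_cst.
  by apply: ctsB; [exact: idC_cts|exact: cts_cst].
rewrite /tri_int !(seg_int_deriv (F := F))//; [ring|exact: fc..].
Qed.

End Goursat.

(** * Goursat's theorem *)

Section Primitive.
Variable R : realType.
Local Notation C := (R[i]^o).
Implicit Types (f g : C -> C) (a b c z w p : C) (s t : R).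

Lemma exists_pow2_small (x e : R) : 0 < e -> exists n, x / 2 ^+ n < e.
Proof.
move=> e0; have [n /= nx] : exists n : nat, x / e < n%:R.
  by exists (Num.trunc (x / e)).+1; exact: truncnS_gt.
exists n; rewrite ltr_pdivrMr ?exprn_gt0//; rewrite ltr_pdivrMr// in nx.
apply: (lt_le_trans nx); rewrite mulrC ler_wpM2l ?(ltW e0)//.
by rewrite -natrX ler_nat ltnW// ltn_expl.
Qed.

(** Subdivide repeatedly, keeping a triangle with at least a quarter of the
    integral.  The triangles shrink to a point [z]; there [f] is affine up to an
    error that is small compared with the distance to [z], so that the integral
    over the n-th triangle is small compared with [4 ^- n]. *)
Theorem goursat f a b c :
  (forall z, hull a b c z -> exists l, cderiv f z l) -> tri_int f a b c = 0.
Proof.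
move=> fd; pose T0 := (a, b, c).
have fc : cts_hull f T0 by move=> z /fd[l]; exact: cderiv_cts.
have ex T : exists U, cts_hull f T ->
    subtri T U /\ cabs (tint f T) <= 4 * cabs (tint f U).
  have [/subtri_large[U HU]|nT] := pselect (cts_hull f T).
    by exists U.
  by exists T.
have [nx nxP] := choice ex.
pose T n := iter n nx T0.
have Tin n : thull (T n) `<=` thull T0.
  elim: n => [//|n ih]; apply: subset_trans (ih).
  have fcn : cts_hull f (T n) by move=> z /ih; exact: fc.
  exact: subtri_hull (nxP _ fcn).1.
have fcn n : cts_hull f (T n) by move=> z /Tin; exact: fc.
have Tle n m : (n <= m)%N -> thull (T m) `<=` thull (T n).
  elim: m => [|m ih]; first by rewrite leqn0 => /eqP ->.
  rewrite leq_eqVlt => /orP[/eqP -> //|]; rewrite ltnS => /ih h.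
  by apply: subset_trans (h); exact: subtri_hull (nxP _ (fcn m)).1.
pose d := cabs (b - a) + cabs (c - b) + cabs (a - c).
have d0 : 0 <= d by rewrite !addr_ge0 ?cabs_ge0.
have Tsm n : tsmall (d / 2 ^+ n) (T n).
  elim: n => [|n ih].
    rewrite expr0 divr1 /d; split; have := cabs_ge0 (b - a);
    have := cabs_ge0 (c - b); have := cabs_ge0 (a - c); lra.
  have -> : d / 2 ^+ n.+1 = d / 2 ^+ n / 2 by rewrite exprSr invfM mulrA.
  exact: subtri_small (nxP _ (fcn n)).1 ih.
have Tbig n : cabs (tint f T0) <= 4 ^+ n * cabs (tint f (T n)).
  elim: n => [|n ih]; first by rewrite expr0 mul1r.
  apply: le_trans ih _; rewrite exprSr -mulrA ler_wpM2l ?exprn_ge0//.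
  exact: (nxP _ (fcn n)).2.
pose v n : C := (T n).1.1.
have vin n : thull (T n) (v n).
  by rewrite /v; case: (T n) => -[x y] u; exact: hull_vertex.
have dist n z : thull (T n) z -> cabs (z - v n) <= d / 2 ^+ n.
  have := Tsm n; rewrite /v; case: (T n) => -[x y] u /= [h1 h2 h3] hz.
  by apply: hull_dist hz _ _ => //; rewrite cabsC.
(* The limit point is a cluster point of the first vertices. *)
have [|z [zK zc]] := @hull_compact R a b c (v @ \oo) _.
  by exists 0%N => // n _ /=; exact: (Tin n _ (vin n)).
have zd n : cabs (z - v n) <= d / 2 ^+ n.
  rewrite leNgt; apply/negP => h.
  pose e := cabs (z - v n) - d / 2 ^+ n.
  have [||_ [[m nm <-] /= hm]] := zc [set v m | m in [set m | (n <= m)%N]]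
      [set w | cabs (w - z) < e].
  - by exists n => // m /= nm; exists m.
  - by apply/nbhs_cabsP; exists e => //; rewrite subr_gt0.
  have := dist n (v m) (Tle _ _ nm _ (vin m)).
  have := cabsT (v m) z (v n); rewrite (cabsC z (v m)); move: hm; rewrite /e; lra.
have {}zd n w : thull (T n) w -> cabs (w - z) <= 2 * (d / 2 ^+ n).
  move=> /dist h; have := cabsT (v n) w z; rewrite (cabsC (v n) z).
  have := zd n; lra.
have [l /cderivP[q [ql qc [r r0 fr]]]] := fd z zK.
suff H e : 0 < e -> cabs (tint f T0) <= 6 * d ^+ 2 * e.
  apply/eqP; rewrite -cabs_eq0 -/(tint f T0) eq_le cabs_ge0 andbT.
  apply/ler_addgt0Pr => e e0; rewrite add0r.
  have D0 : 0 < 6 * d ^+ 2 + 1 by rewrite ltr_wpDl// mulr_ge0// sqr_ge0.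
  apply: le_trans (H (e / (6 * d ^+ 2 + 1)) _) _; first by rewrite divr_gt0.
  by rewrite mulrCA ger_pMr// ler_pdivrMr// mul1r lerDl.
move=> e0; have [r' r'0 Hr'] := (cts_cabsP _ _).1 qc _ e0.
have [n nr] : exists n, 2 * d / 2 ^+ n < Num.min r r'.
  by apply: exists_pow2_small; rewrite lt_min r0.
(* Subtracting the affine approximation at [z] leaves the integral unchanged. *)
pose g w := f z + l * (w - z).
have E : tint f (T n) = tint (fun w => f w - g w) (T n).
  have : cts_hull f (T n) by exact: fcn.
  case: (T n) => -[x y] u /cts_hull_seg[f1 f2 f3] /=.
  have gc x' y' : cts_seg g x' y'.
    move=> t _; apply: ctsD; first exact: cts_cst.
    apply: ctsM; first exact: cts_cst.
    by apply: ctsB; [exact: idC_cts|exact: cts_cst].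
  have := tri_int_affine (f z) l z x y u; rewrite -/g /tri_int => g0.
  rewrite (seg_intB f1 (gc _ _)) (seg_intB f2 (gc _ _)) (seg_intB f3 (gc _ _)).
  by rewrite -[LHS]subr0 -[X in _ - X]g0; ring.
have rem w : thull (T n) w -> cabs (f w - g w) <= e * (2 * (d / 2 ^+ n)).
  move=> hw; have hd := zd _ _ hw.
  have : cabs (w - z) < Num.min r r' by apply: le_lt_trans hd _; rewrite mulrA.
  rewrite lt_min => /andP[h1 h2].
  have -> : f w - g w = (q w - q z) * (w - z) by rewrite (fr _ h1) /g ql; ring.
  rewrite cabsM; apply: ler_pM; [exact: cabs_ge0|exact: cabs_ge0| |exact: hd].
  exact/ltW/Hr'.
have : cabs (tint f (T n)) <= e * (2 * (d / 2 ^+ n)) * (3 * (d / 2 ^+ n)).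
  rewrite E; have := Tsm n; have := fcn n; move: rem.
  case: (T n) => -[x y] u rem hc [s1 s2 s3] /=.
  have gc w : {for w, continuous g}.
    apply: ctsD; first exact: cts_cst.
    apply: ctsM; first exact: cts_cst.
    by apply: ctsB; [exact: idC_cts|exact: cts_cst].
  have hc' : cts_hull (fun w => f w - g w) (x, y, u).
    by move=> w hw; apply: ctsB; [exact: hc|exact: gc].
  have [f1 f2 f3] := cts_hull_seg hc'.
  set M := e * _; have M0 : 0 <= M.
    by rewrite /M !mulr_ge0 ?invr_ge0 ?exprn_ge0// ltW.
  have i1 : cabs (seg_int (fun w => f w - g w) x y) <= M * (d / 2 ^+ n).
    apply: le_trans (seg_int_le (M := M) f1 _) _; last exact: ler_wpM2l.
    by move=> t t01; apply: rem => /=; exact: hull_seg.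
  have i2 : cabs (seg_int (fun w => f w - g w) y u) <= M * (d / 2 ^+ n).
    apply: le_trans (seg_int_le (M := M) f2 _) _; last exact: ler_wpM2l.
    by move=> t t01; apply: rem => /=; rewrite hull_rot; exact: hull_seg.
  have i3 : cabs (seg_int (fun w => f w - g w) u x) <= M * (d / 2 ^+ n).
    apply: le_trans (seg_int_le (M := M) f3 _) _; last exact: ler_wpM2l.
    by move=> t t01; apply: rem => /=; rewrite 2!hull_rot; exact: hull_seg.
  rewrite /tri_int; apply: le_trans (cabsD _ _) _.
  have := cabsD (seg_int (fun w => f w - g w) x y) (seg_int (fun w => f w - g w) y u).
  lra.
move=> h; apply: le_trans (Tbig n) _.
have p4 : 0 < (4 : R) ^+ n by rewrite exprn_gt0.
apply: le_trans (ler_wpM2l (ltW p4) h) _.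
have -> : (4 : R) ^+ n = 2 ^+ n * 2 ^+ n.
  by rewrite -exprMn; congr (_ ^+ n); ring.
have p2 : (2 : R) ^+ n != 0 by rewrite expf_neq0.
by rewrite le_eqVlt; apply/orP; left; apply/eqP; field.
Qed.

End Primitive.

(** * Primitives on convex open sets *)

Section PrimitiveTheorem.
Variable R : realType.
Local Notation C := (R[i]^o).
Implicit Types (f g : C -> C) (a b c z w p : C) (s t : R) (W : set C).

Definition openC W := forall z, W z ->
  exists2 r : R, 0 < r & forall w, cabs (w - z) < r -> W w.
Definition convexC W := forall x y t, 0 <= t <= 1 -> W x -> W y -> W (seg x y t).
Definition holo W f := forall z, W z -> exists l, cderiv f z l.

Lemma holo_cts W f z : holo W f -> W z -> {for z, continuous f}.
Proof. by move=> h /h[l]; exact: cderiv_cts. Qed.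

Lemma convex_hull W a b c z : convexC W -> W a -> W b -> W c ->
  hull a b c z -> W z.
Proof.
move=> cW Wa Wb Wc /hull_segP[s [t [s01 t01 ->]]].
by apply: (cW _ _ _ s01 Wa); exact: (cW _ _ _ t01).
Qed.

Definition disc (c : C) (r : R) : set C := [set z | cabs (z - c) < r].

Lemma disc_open c r : openC (disc c r).
Proof.
move=> z zr; exists (r - cabs (z - c)); first by rewrite subr_gt0.
by move=> w h; rewrite /disc /=; have := cabsT z w c; lra.
Qed.

Lemma disc_convex c r : convexC (disc c r).
Proof.
move=> x y t t01 xr yr; rewrite /disc /=.
have -> : seg x y t - c = (1 - t)%:C * (x - c) + t%:C * (y - c).
  by rewrite /seg !realCE; ring.
apply: le_lt_trans (cabsD _ _) _; rewrite !cabsM !cabsr !ger0_norm; try lra.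
move: xr yr; rewrite /disc /= => xr yr; have /andP[t0 t1] := t01.
have [->|tn] := eqVneq t 0; first lra.
have tp : 0 < t by rewrite lt_neqAle eq_sym tn.
nra.
Qed.

Lemma openC_T : openC setT. Proof. by move=> z _; exists 1. Qed.
Lemma convexC_T : convexC setT. Proof. by []. Qed.

Lemma cabs_le_small_eq0 z B s0 : 0 < s0 -> 0 <= B ->
  (forall s, 0 < s -> s <= s0 -> cabs z <= s * B) -> z = 0.
Proof.
move=> s00 B0 H; apply/eqP; rewrite -cabs_eq0 eq_le cabs_ge0 andbT.
apply/ler_addgt0Pr => e e0; rewrite add0r.
have B1 : 0 < B + 1 by lra.
have m0 : 0 < Num.min s0 (e / (B + 1)) by rewrite lt_min s00 divr_gt0.
apply: le_trans (H _ m0 _) _; first by rewrite ge_min lexx.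
apply: (@le_trans _ _ (e / (B + 1) * B)).
  by rewrite ler_wpM2r// ge_min lexx orbT.
by rewrite mulrAC ler_pdivrMr//; nra.
Qed.

Section Star.
Variables (W : set C) (f : C -> C) (p : C).
Hypothesis (oW : openC W) (cW : convexC W) (Wp : W p).
Hypothesis fc : forall z, W z -> {for z, continuous f}.
Hypothesis fd : forall z, W z -> z != p -> exists l, cderiv f z l.

Lemma star_cts_seg a b : W a -> W b -> cts_seg f a b.
Proof. by move=> Wa Wb t t01; apply: fc; exact: cW. Qed.

Lemma tri_int_off a b c : W a -> W b -> W c -> ~ hull a b c p ->
  tri_int f a b c = 0.
Proof.
move=> Wa Wb Wc np; apply: goursat => z hz; apply: fd.
  exact: convex_hull hz.
by apply/eqP => zp; apply: np; rewrite -zp.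
Qed.

(** Cutting off the corner at the exceptional point [p] by a factor [s] leaves two
    triangles that avoid [p], where Goursat's theorem applies.  The small triangle
    at [p] contributes at most a constant times [s]. *)
Lemma tri_int_star z w : W z -> W w -> cabs (w - z) < cabs (z - p) / 2 ->
  tri_int f p z w = 0.
Proof.
move=> Wz Ww zw; have [d d0 Hd] := (cts_cabsP _ _).1 (fc Wp) _ ltr01.
pose M := cabs (f p) + 1.
have M0 : 0 < M by rewrite ltr_wpDl ?cabs_ge0.
have zp0 : 0 < cabs (z - p) by have := cabs_ge0 (w - z); lra.
pose D := cabs (z - p) + cabs (w - z) + cabs (w - p) + 1.
have D0 : 0 < D by rewrite ltr_wpDl ?addr_ge0 ?cabs_ge0.
pose s0 := Num.min 1 (d / 2 / D).
have s00 : 0 < s0 by rewrite lt_min ltr01 !divr_gt0.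
apply: (@cabs_le_small_eq0 _ (M * D) s0 s00); first by rewrite mulr_ge0 ?ltW.
move=> s sp ss0; have s1 : s <= 1 by apply: le_trans ss0 _; rewrite ge_min lexx.
have sD : s * D <= d / 2 by rewrite -ler_pdivlMr// (le_trans ss0)// ge_min lexx orbT.
have s01 : 0 <= s <= 1 by rewrite ltW.
pose zs := seg p z s; pose ws := seg p w s.
have Wzs : W zs by exact: cW. have Wws : W ws by exact: cW.
(* Relative to [p], the points of the two large triangles have this form, with
   [u <= 2 k]; hence [p] is not among them. *)
have low (k u : R) : 0 < k -> 0 <= u -> u <= 2 * k ->
    k%:C * (z - p) + u%:C * (w - z) != 0.
  move=> k0 u0 uk; apply: contraTneq zw => E; rewrite -leNgt.
  have : cabs (k%:C * (z - p)) = cabs (u%:C * (w - z)).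
    by rewrite -[LHS]cabsN; congr cabs; apply/eqP; rewrite eqr_oppLR -addr_eq0 E.
  rewrite !cabsM !cabsr (ger0_norm u0) (gtr0_norm k0) => E'.
  have := cabs_ge0 (w - z); nra.
have T1 : tri_int f zs z w = 0.
  apply: tri_int_off => // -[x [y [u [x0 y0 u0 e E]]]].
  have k0 : 0 < x * s + y + u by nra.
  have := low _ u k0 u0; rewrite !realCE => /(_ _) /eqP; apply; first by nra.
  have xE : x%:C = 1 - y%:C - u%:C :> C by rewrite -realC1 -!realCB; congr (_%:C); lra.
  rewrite -(subrr p) [X in _ = X - _]E /zs /seg xE; ring.
have T2 : tri_int f zs w ws = 0.
  apply: tri_int_off => // -[x [y [u [x0 y0 u0 e E]]]].
  have k0 : 0 < x * s + y + u * s by nra.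
  have u0' : 0 <= y + u * s by nra.
  have := low _ _ k0 u0'; rewrite !realCE => /(_ _) /eqP; apply; first by nra.
  have xE : x%:C = 1 - y%:C - u%:C :> C by rewrite -realC1 -!realCB; congr (_%:C); lra.
  rewrite -(subrr p) [X in _ = X - _]E /zs /ws /seg xE; ring.
have E : tri_int f p z w = tri_int f p zs ws.
  rewrite -[RHS]addr0 -[RHS]addr0 -{1}T1 -T2 /tri_int.
  rewrite (seg_int_split s01 (star_cts_seg Wp Wz)) -/zs.
  rewrite (seg_int_rev (star_cts_seg Wp Ww)) (seg_int_split s01 (star_cts_seg Wp Ww)) -/ws.
  rewrite (seg_int_rev (star_cts_seg Wp Wws)).
  rewrite (seg_int_rev (star_cts_seg Wzs Ww)) (seg_int_rev (star_cts_seg Wzs Wws)).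
  rewrite (seg_int_rev (star_cts_seg Wws Ww)); ring.
rewrite E.
have zsE : zs - p = s%:C * (z - p) by rewrite /zs /seg; ring.
have wsE : ws - p = s%:C * (w - p) by rewrite /ws /seg; ring.
have wzE : ws - zs = s%:C * (w - z) by rewrite /zs /ws /seg; ring.
have cs : cabs s%:C = s by rewrite cabsr ger0_norm// ltW.
have := cabs_ge0 (z - p); have := cabs_ge0 (w - z); have := cabs_ge0 (w - p).
move=> P1 P2 P3.
have bnd v : hull p zs ws v -> cabs (f v) <= M.
  move=> hv; have : cabs (v - p) <= d / 2.
    apply: hull_dist hv _ _; rewrite ?zsE ?wsE cabsM cs; apply: le_trans sD.
      by rewrite /D; nra.
    by rewrite /D; nra.
  move=> vd; have {}vd : cabs (v - p) < d by lra.
  have := Hd _ vd; have := cabsD (f v - f p) (f p); rewrite subrK /M; lra.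
have i1 : cabs (seg_int f p zs) <= M * (s * cabs (z - p)).
  rewrite -cs -cabsM -zsE; apply: seg_int_le; first exact: star_cts_seg.
  by move=> t t01; apply: bnd; exact: hull_seg.
have i2 : cabs (seg_int f zs ws) <= M * (s * cabs (w - z)).
  rewrite -cs -cabsM -wzE; apply: seg_int_le; first exact: star_cts_seg.
  by move=> t t01; apply: bnd; rewrite hull_rot; exact: hull_seg.
have i3 : cabs (seg_int f ws p) <= M * (s * cabs (w - p)).
  rewrite -cs -cabsM -wsE cabsC; apply: seg_int_le; first exact: star_cts_seg.
  by move=> t t01; apply: bnd; rewrite 2!hull_rot; exact: hull_seg.
rewrite /tri_int; apply: le_trans (cabsD _ _) _.
have := cabsD (seg_int f p zs) (seg_int f zs ws).
have -> : s * (M * D) = M * (s * cabs (z - p)) + M * (s * cabs (w - z)) +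
  M * (s * cabs (w - p)) + M * s by rewrite /D; ring.
have : 0 < M * s by rewrite mulr_gt0.
lra.
Qed.

(** Integration along segments from [p] is a primitive even if [f] is only
    continuous at [p]; this is what is needed for difference quotients based at
    [p]. *)
Theorem star_primitive z : W z -> cderiv (seg_int f p) z (f z).
Proof.
move=> Wz; have [r r0 Hr] := oW Wz.
have main : exists2 d : R, 0 < d & forall w, cabs (w - z) < d ->
    W w /\ seg_int f p w = seg_int f p z + seg_int f z w.
  have [zp|zp] := eqVneq z p.
    exists r => // w /Hr Ww; split=> //; rewrite zp.
    by rewrite [X in _ = X + _]/seg_int subrr mul0r add0r.
  exists (Num.min r (cabs (z - p) / 2)).
    by rewrite lt_min r0 divr_gt0// cabs_gt0 subr_eq0.
  move=> w; rewrite lt_min => /andP[/Hr Ww h]; split=> //.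
  have := tri_int_star Wz Ww h; rewrite /tri_int.
  rewrite (seg_int_rev (star_cts_seg Wp Ww)) => /eqP.
  by rewrite subr_eq0 => /eqP ->.
have [d d0 Hd] := main.
apply/cderivP; exists (fun w => integral01 (fun t => f (seg z w t))); split.
- have -> : (fun t => f (seg z z t)) = fun=> f z.
    by apply/funext => t; rewrite /seg subrr mulr0 addr0.
  exact: integral01_cst.
- apply/cts_cabsP => e e0.
  have e2 : 0 < e / 2 by rewrite divr_gt0.
  have [d' d'0 Hd'] := (cts_cabsP _ _).1 (fc Wz) _ e2.
  exists (Num.min d d'); first by rewrite lt_min d0.
  move=> w; rewrite lt_min => /andP[wd wd'].
  have -> : (fun t => f (seg z z t)) = fun=> f z.
    by apply/funext => t; rewrite /seg subrr mulr0 addr0.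
  have sc := cts_seg01 (star_cts_seg Wz (Hd _ wd).1).
  rewrite -(integral01B sc); last by move=> t _; exact: cts_cst.
  apply: (@le_lt_trans _ _ (e / 2)); last by lra.
  apply: integral01_le => [t t01|t t01].
    by apply: ctsB; [exact: sc|exact: cts_cst].
  apply/ltW/Hd'; apply: le_lt_trans wd'.
  have -> : seg z w t - z = t%:C * (w - z) by rewrite /seg; ring.
  rewrite cabsM cabsr ger0_norm; last lra.
  have := cabs_ge0 (w - z); nra.
- exists d => // w /Hd[_ ->]; rewrite /seg_int; ring.
Qed.

End Star.
End PrimitiveTheorem.

(** * The complex exponential *)

Section Exponential.
Variable R : realType.
Local Notation C := (R[i]^o).
Implicit Types (z w : C).

Definition cexp (z : C) : C :=
  (expR (complex.Re z))%:C * (cos (complex.Im z) +i* sin (complex.Im z)).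

Lemma cexpD z w : cexp (z + w) = cexp z * cexp w.
Proof.
case: z => a b; case: w => c d; rewrite /cexp /= expRD cosD sinD realCM.
simpc; congr (_ +i* _); ring.
Qed.

Lemma cexp0 : cexp 0 = 1.
Proof. by rewrite /cexp /= expR0 cos0 sin0 mul1r. Qed.

Lemma cexpN z : cexp (- z) * cexp z = 1.
Proof. by rewrite -cexpD addNr cexp0. Qed.

Lemma cexp_neq0 z : cexp z != 0.
Proof.
have := cexpN z; apply: contra_eqN => /eqP ->; by rewrite mulr0 eq_sym oner_eq0.
Qed.

Lemma cexpNV z : cexp (- z) = (cexp z)^-1.
Proof. by apply: (mulIf (cexp_neq0 z)); rewrite cexpN mulVf// cexp_neq0. Qed.

Lemma cexp_natM n z : cexp (n%:R * z) = cexp z ^+ n.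
Proof.
elim: n => [|n ih]; first by rewrite mul0r cexp0.
by rewrite exprS -ih -cexpD -natr1; congr cexp; ring.
Qed.

Lemma cexp_real (x : R) : cexp x%:C = (expR x)%:C.
Proof. by rewrite /cexp /= cos0 sin0 complexr0 mulr1. Qed.

Lemma cabs_cis (t : R) : cabs (cos t +i* sin t) = 1.
Proof. by rewrite /cabs /= cos2Dsin2 sqrtr1. Qed.

Definition twopii : C := 0 +i* (pi *+ 2).

Lemma cexp_2pii : cexp twopii = 1.
Proof. by rewrite /cexp /= expR0 cos2pi sin2pi mul1r. Qed.

Lemma twopii_neq0 : twopii != 0.
Proof.
rewrite eq_complex /= negb_and; apply/orP; right.
by rewrite mulrn_eq0 /= gt_eqF// pi_gt0.
Qed.

(** Polar coordinates: the angle is an arc cosine, up to the sign prescribed by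
    the imaginary part. *)
Lemma cexp_surj w : w != 0 -> exists z, cexp z = w.
Proof.
move=> w0; have n0 : 0 < cabs w by rewrite cabs_gt0.
case: w w0 n0 => a b w0; set r := cabs _ => r0.
have rE : r ^+ 2 = a ^+ 2 + b ^+ 2.
  by rewrite /r /cabs /= sqr_sqrtr// addr_ge0 ?sqr_ge0.
have ab1 : (a / r) ^+ 2 + (b / r) ^+ 2 = 1.
  by rewrite !expr_div_n -mulrDl -rE divff// expf_neq0 ?gt_eqF.
have a1 : -1 <= a / r <= 1.
  by rewrite -ler_norml -(expr_le1 (n := 2)) ?normr_ge0// -normrX
     ger0_norm ?sqr_ge0// -ab1 lerDl sqr_ge0.
have [t ct st] : exists2 t : R, cos t = a / r & sin t = b / r.
  have sE : sin (acos (a / r)) = `|b / r|.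
    rewrite sin_acos// -sqrtr_sqr; congr Num.sqrt; lra.
  have cE : cos (acos (a / r)) = a / r by apply: acosK; rewrite in_itv.
  have [b0|b0] := leP 0 (b / r).
    by exists (acos (a / r)); rewrite // sE ger0_norm.
  exists (- acos (a / r)); first by rewrite cosN.
  by rewrite sinN sE ltr0_norm// opprK.
exists (ln r +i* t); rewrite /cexp /= ct st lnK ?posrE//; simpc.
by rewrite mulrC divfK ?gt_eqF// mulrC divfK ?gt_eqF.
Qed.

(** The error [exp h - 1 - h] is expanded by means of the slope functions [a], [b],
    [c] at 0 of the real exponential, cosine and sine. *)
Lemma cexp_deriv0 : cderiv cexp 0 1.
Proof.
have [a [a0 ac Ha]] := is_derive_caratheodory (is_derive_expR (0 : R)).
have [b [b0 bc Hb]] := is_derive_caratheodory (is_derive_cos (0 : R)).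
have [c [c0 cc Hc]] := is_derive_caratheodory (is_derive_sin (0 : R)).
rewrite expR0 in a0; rewrite sin0 oppr0 in b0; rewrite cos0 in c0.
have {}Ha x : expR x = 1 + a x * x by rewrite Ha expR0 subr0.
have {}Hb x : cos x = 1 + b x * x by rewrite Hb cos0 subr0.
have {}Hc x : sin x = c x * x by rewrite Hc sin0 subr0 add0r.
have modulus (p : R -> R) (l e : R) : p 0 = l -> {for 0, continuous p} -> 0 < e ->
    exists2 d, 0 < d & forall x, `|x| < d -> `|p x - l| < e.
  move=> <- pc e0.
  have [d /= d0 Hd] := (nbhs_ballP _ _).1 ((@cvgrPdist_lt _ _ _ (nbhs (0 : R)) _ _ _).1 pc _ e0).
  exists d => // x xd; rewrite distrC; apply: Hd.
  by rewrite /ball /= sub0r normrN.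
apply/cderivP; exists (fun h => if h == 0 then 1 else (cexp h - 1) / h); split.
- by rewrite eqxx.
- apply/cts_cabsP => e e0; rewrite eqxx.
  have [n [n0 n1 ne]] : exists n : R, [/\ 0 < n, n <= 1 & n <= e / 10].
    exists (Num.min 1 (e / 10)).
    by rewrite lt_min ltr01 divr_gt0// !ge_min !lexx orbT.
  have [d1 d10 H1] := modulus _ _ _ a0 ac n0.
  have [d2 d20 H2] := modulus _ _ _ b0 bc n0.
  have [d3 d30 H3] := modulus _ _ _ c0 cc n0.
  exists (Num.min (Num.min d1 n) (Num.min d2 d3)).
    by rewrite !lt_min d10 n0 d20 d30.
  move=> h; rewrite subr0 !lt_min => /andP[/andP[h1 hn] /andP[h2 h3]].
  case: eqP => [_|/eqP h0]; first by rewrite subrr cabs0.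
  have hp : 0 < cabs h by rewrite cabs_gt0.
  have -> : (cexp h - 1) / h - 1 = (cexp h - 1 - h) / h by field.
  rewrite cabsM cabsV ltr_pdivrMr//.
  have xh := Re_le_cabs h; have yh := Im_le_cabs h.
  pose x := complex.Re h; pose y := complex.Im h.
  rewrite -/x -/y in xh yh.
  have {}H1 := H1 _ (le_lt_trans xh h1).
  have {}H2 := H2 _ (le_lt_trans yh h2); rewrite subr0 in H2.
  have {}H3 := H3 _ (le_lt_trans yh h3).
  have hE : h = x%:C + y%:C * 'i.
    by rewrite /x /y; case: (h) => u v; simpc.
  have ci : cabs 'i = 1 :> R by rewrite /cabs /= expr0n /= add0r expr1n sqrtr1.
  have E : cexp h - 1 - h = (a x - 1)%:C * x%:C + (b y)%:C * y%:C +
     ((c y - 1)%:C * y%:C) * 'i +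
     ((a x)%:C * x%:C) * (((b y)%:C + (c y)%:C * 'i) * y%:C).
    rewrite [X in _ - X]hE /cexp -/x -/y Ha Hb Hc.
    have -> : (1 + b y * y) +i* (c y * y) = 1 + (b y)%:C * y%:C + (c y)%:C * y%:C * 'i :> C.
      by simpc.
    by rewrite !realCE; ring.
  have t1 : cabs ((a x - 1)%:C * x%:C : C) <= n * cabs h.
    by rewrite cabsM !cabsr ler_pM// ltW.
  have t2 : cabs ((b y)%:C * y%:C : C) <= n * cabs h.
    by rewrite cabsM !cabsr ler_pM// ltW.
  have t3 : cabs ((c y - 1)%:C * y%:C * 'i : C) <= n * cabs h.
    by rewrite cabsM ci mulr1 cabsM !cabsr ler_pM// ltW.
  have a2 : `|a x| <= 2.
    by have := ler_normD (a x - 1) 1; rewrite subrK normr1; lra.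
  have c2 : `|c y| <= 2.
    by have := ler_normD (c y - 1) 1; rewrite subrK normr1; lra.
  have t4 : cabs ((a x)%:C * x%:C * (((b y)%:C + (c y)%:C * 'i) * y%:C) : C)
      <= 6 * n * cabs h.
    rewrite cabsM cabsM !cabsr (cabsM _ y%:C) cabsr.
    have u1 : `|a x| * `|x| <= 2 * cabs h by rewrite ler_pM.
    have u2 : cabs ((b y)%:C + (c y)%:C * 'i : C) <= 3.
      apply: le_trans (cabsD _ _) _; rewrite cabsM ci mulr1 !cabsr; lra.
    have u3 : `|y| <= n by apply/ltW/(le_lt_trans yh).
    have u4 : cabs ((b y)%:C + (c y)%:C * 'i : C) * `|y| <= 3 * n.
      by rewrite ler_pM// cabs_ge0.
    have -> : 6 * n * cabs h = (2 * cabs h) * (3 * n) by ring.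
    by rewrite ler_pM// ?mulr_ge0// ?cabs_ge0.
  have : cabs (cexp h - 1 - h) <= 9 * n * cabs h.
    rewrite E; apply: le_trans (cabsD _ _) _.
    have := cabsD ((a x - 1)%:C * x%:C + (b y)%:C * y%:C : C) ((c y - 1)%:C * y%:C * 'i).
    have := cabsD ((a x - 1)%:C * x%:C : C) ((b y)%:C * y%:C).
    lra.
  move=> /le_lt_trans; apply; rewrite ltr_pM2r//; lra.
- exists 1 => // h _; rewrite cexp0 subr0.
  by case: eqP => [->|/eqP h0]; rewrite ?cexp0 ?mulr0 ?addr0// divfK// addrC subrK.
Qed.

Lemma cexp_deriv z : cderiv cexp z (cexp z).
Proof.
have h : cderiv (fun w => cexp z * cexp (w - z)) z (cexp z * (1 * (1 - 0))).
  apply: cderivZ; apply: (@cderiv_comp _ (fun w => w - z)).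
    by apply: cderivB; [exact: cderiv_id|exact: cderiv_cst].
  by rewrite subrr; exact: cexp_deriv0.
rewrite subr0 !mulr1 in h.
apply: (cderiv_local (d := 1)) h => // w _.
by rewrite -cexpD addrC subrK.
Qed.

Lemma cderiv_cexp f z l : cderiv f z l ->
  cderiv (fun w => cexp (f w)) z (cexp (f z) * l).
Proof. by move=> df; apply: cderiv_comp df _; exact: cexp_deriv. Qed.

End Exponential.

(** * Cauchy's formula on circles *)

Section Cauchy.
Variable R : realType.
Local Notation C := (R[i]^o).
Implicit Types (f g : C -> C) (a b c z w p : C) (s t r : R) (W : set C).

Definition dslope f a D : C -> C :=
  fun w => if w == a then D else (f w - f a) / (w - a).

Lemma dslopeE f a D w : f w = f a + (w - a) * dslope f a D w.
Proof.
rewrite /dslope; case: eqP => [->|/eqP h]; first by rewrite subrr mul0r addr0.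
by rewrite mulrCA divff ?mulr1 ?subr_eq0// addrC subrK.
Qed.

Lemma dslope_off f a D w l : w != a -> cderiv f w l ->
  exists l', cderiv (dslope f a D) w l'.
Proof.
move=> wa dw; have wa0 : w - a != 0 by rewrite subr_eq0.
have h := cderivM (cderivB dw (cderiv_cst (f a) w))
  (cderivV (f := fun w => w - a) wa0 (cderiv_subr a w)).
eexists; apply: (cderiv_local (d := cabs (w - a))) h; first by rewrite cabs_gt0.
move=> z zw /=; rewrite /dslope; case: eqP => // za.
by move: zw; rewrite za cabsC ltxx.
Qed.

Lemma dslope_cts f a D : cderiv f a D -> {for a, continuous (dslope f a D)}.
Proof.
move=> /cderivP[q [qa qc [d d0 Hd]]].
apply/cts_cabsP => e e0; have [d' d'0 Hd'] := (cts_cabsP _ _).1 qc _ e0.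
exists (Num.min d d'); first by rewrite lt_min d0.
move=> w; rewrite lt_min => /andP[wd wd']; rewrite /dslope eqxx.
case: eqP => [_|/eqP wa]; first by rewrite subrr cabs0.
have wa0 : w - a != 0 by rewrite subr_eq0.
by rewrite (Hd _ wd) addrAC subrr add0r mulfK// -qa; exact: Hd'.
Qed.

(** The difference quotient is continuous at [a] and differentiable elsewhere,
    which is exactly what integration along segments from [a] tolerates. *)
Lemma dslope_primitive W f a D : openC W -> convexC W -> W a -> holo W f ->
  cderiv f a D -> exists G, forall z, W z -> cderiv G z (dslope f a D z).
Proof.
move=> oW cW Wa hf da; exists (seg_int (dslope f a D) a) => z Wz.
apply: (star_primitive oW cW Wa) Wz => [w Ww|w Ww wa].
  have [->|wa] := eqVneq w a; first exact: dslope_cts.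
  have [l dw] := hf w Ww; have [l' dw'] := dslope_off D wa dw.
  exact: cderiv_cts dw'.
by have [l dw] := hf w Ww; exact: dslope_off wa dw.
Qed.

Definition circ c r t : C := c + r%:C * cexp (t%:C * twopii R).

Lemma circ0 c r : circ c r 0 = c + r%:C.
Proof. by rewrite /circ realC0 mul0r cexp0 mulr1. Qed.
Lemma circ1 c r : circ c r 1 = c + r%:C.
Proof. by rewrite /circ realC1 mul1r cexp_2pii mulr1. Qed.

Lemma circ_abs c r t : 0 <= r -> cabs (circ c r t - c) = r.
Proof.
move=> r0; rewrite /circ addrAC subrr add0r cabsM cabsr ger0_norm//.
have -> : t%:C * twopii R = 0 +i* (t * (pi *+ 2)) by rewrite /twopii; simpc.
by rewrite /cexp /= expR0 mul1r cabs_cis mulr1.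
Qed.

Lemma circ_deriv c r t :
  rderiv (circ c r) t (twopii R * (circ c r t - c)).
Proof.
have h : rderiv (fun t => t%:C * twopii R) t (twopii R).
  have := rderivM (has_deriv_iota _ t) (has_deriv_cst _ (twopii R) t).
  by rewrite mul1r mulr0 addr0.
have := rderivZ r%:C (rderiv_comp h (cexp_deriv _)).
move=> /(has_derivD (has_deriv_cst _ c t)); rewrite add0r.
have -> : r%:C * (cexp (t%:C * twopii R) * twopii R) =
   twopii R * (circ c r t - c) by rewrite /circ; ring.
exact.
Qed.

Lemma circ_cts c r t : {for t, continuous (circ c r)}.
Proof. exact: rderiv_cts (circ_deriv c r t). Qed.

Lemma circ_int_primitive g G c r :
  (forall t, 0 <= t <= 1 -> cderiv G (circ c r t) (g (circ c r t))) ->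
  integral01 (fun t => g (circ c r t) * (twopii R * (circ c r t - c))) = 0.
Proof.
move=> dG; rewrite (@integral01E _ _ (fun t => G (circ c r t))).
  by rewrite circ0 circ1 subrr.
by move=> t t01; apply: rderiv_comp (dG _ t01); exact: circ_deriv.
Qed.

(** Differentiation under the integral sign, where the difference quotients in the
    parameter are given in closed form by [Q]. *)
Lemma integral01_deriv (F Q : R -> C -> C) a d : 0 < d ->
  (forall b, cabs (b - a) < d -> [/\ cts01 (F ^~ b), cts01 (Q ^~ b) &
     forall t, 0 <= t <= 1 -> F t b = F t a + (b - a) * Q t b]) ->
  (forall t, 0 <= t <= 1 ->
     {for (t, a), continuous (fun x : R * C => Q x.1 x.2)}) ->
  cderiv (fun b => integral01 (F ^~ b)) a (integral01 (Q ^~ a)).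
Proof.
move=> d0 H Qc; apply/cderivP; exists (fun b => integral01 (Q ^~ b)); split.
- by [].
- apply: integral01_cts; first exact: Qc.
  by exists d; [exact: d0|move=> b /H[_ h _]; exact: h].
exists d; first exact: d0.
move=> b bd; have [Fb Qb E] := H b bd.
have [Fa _ _] : [/\ cts01 (F ^~ a), cts01 (Q ^~ a) &
     forall t, 0 <= t <= 1 -> F t a = F t a + (a - a) * Q t a].
  by apply: H; rewrite subrr cabs0.
have Qb' : cts01 (fun t => (b - a) * Q t b).
  by move=> t t01; apply: ctsM; [exact: cts_cst|exact: Qb].
rewrite mulrC -(integral01Z _ Qb) -(integral01D Fa Qb').
exact: eq_integral01 Fb E.
Qed.

Section Circle.
Variables (c : C) (r : R).
Hypothesis r0 : 0 < r.
Local Notation gam := (circ c r).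

Lemma circ_sub_neq0 a t : cabs (a - c) < r -> gam t - a != 0.
Proof.
move=> ar; rewrite subr_eq0; apply: contraTneq ar => <-.
by rewrite circ_abs ?ltW// ltxx.
Qed.

Lemma circ_sub_cts a t : {for t, continuous (fun t => gam t - a)}.
Proof. by apply: ctsB; [exact: circ_cts|exact: cts_cst]. Qed.

Variable phi : R -> C.
Hypothesis phic : cts01 phi.

(** The Cauchy transforms of a density on the circle; each one is the derivative of
    the previous one. *)
Definition cauchy1 a := integral01 (fun t => phi t / (gam t - a)).
Definition cauchy2 a := integral01 (fun t => phi t / (gam t - a) ^+ 2).
Definition cauchy3 a := integral01 (fun t => phi t * 2%:R / (gam t - a) ^+ 3).

Lemma cauchy1_cts01 a : cabs (a - c) < r -> cts01 (fun t => phi t / (gam t - a)).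
Proof.
move=> ar t t01; apply: ctsM; first exact: phic.
by apply: ctsV; [exact: circ_sub_neq0|exact: circ_sub_cts].
Qed.

Lemma cauchy2_cts01 a : cabs (a - c) < r ->
  cts01 (fun t => phi t / (gam t - a) ^+ 2).
Proof.
move=> ar t t01; apply: ctsM; first exact: phic.
apply: ctsV; first by rewrite expf_neq0// circ_sub_neq0.
by apply: ctsM; exact: circ_sub_cts.
Qed.

Let phifst t a : 0 <= t <= 1 ->
  {for (t, a), continuous (fun x : R * C => phi x.1)}.
Proof.
move=> t01; apply: (@cts_comp R (R * C)%type R fst phi (t, a)).
  exact: cvg_fst.
exact: phic.
Qed.

Let gamfst t a : {for (t, a), continuous (fun x : R * C => gam x.1)}.
Proof.
apply: (@cts_comp R (R * C)%type R fst gam (t, a)); first exact: cvg_fst.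
exact: circ_cts.
Qed.

Let sndc t a : {for (t, a), continuous (fun x : R * C => x.2)}.
Proof. exact: cvg_snd. Qed.

Lemma cauchy1_deriv a : cabs (a - c) < r -> cderiv cauchy1 a (cauchy2 a).
Proof.
move=> ar; pose Q t b := phi t / ((gam t - a) * (gam t - b)).
have d0 : 0 < r - cabs (a - c) by rewrite subr_gt0.
have inr b : cabs (b - a) < r - cabs (a - c) -> cabs (b - c) < r.
  by have := cabsT a b c; lra.
have := @integral01_deriv (fun t b => phi t / (gam t - b)) Q a _ d0.
rewrite /cauchy1 /cauchy2; apply.
- move=> b bd; have br := inr _ bd; split.
  + exact: cauchy1_cts01.
  + move=> t t01; apply: ctsM; first exact: phic.
    apply: ctsV; first by rewrite mulf_neq0 ?circ_sub_neq0.
    by apply: ctsM; exact: circ_sub_cts.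
  + move=> t t01; have := circ_sub_neq0 t ar; have := circ_sub_neq0 t br.
    by rewrite /Q => h1 h2; field; rewrite h1 h2.
- move=> t t01; apply: ctsM; first exact: phifst.
  apply: ctsV; first by rewrite mulf_neq0 ?circ_sub_neq0.
  apply: ctsM; apply: ctsB; [exact: gamfst|exact: cts_cst|exact: gamfst|].
  exact: sndc.
Qed.

Lemma cauchy2_deriv a : cabs (a - c) < r -> cderiv cauchy2 a (cauchy3 a).
Proof.
move=> ar.
pose Q t b := phi t * (gam t - a + (gam t - b)) /
  ((gam t - a) ^+ 2 * (gam t - b) ^+ 2).
have d0 : 0 < r - cabs (a - c) by rewrite subr_gt0.
have inr b : cabs (b - a) < r - cabs (a - c) -> cabs (b - c) < r.
  by have := cabsT a b c; lra.
have := @integral01_deriv (fun t b => phi t / (gam t - b) ^+ 2) Q a _ d0.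
rewrite /cauchy2; have -> : integral01 (Q ^~ a) = cauchy3 a.
  rewrite /cauchy3; congr integral01; apply/funext => t; rewrite /Q.
  by have := circ_sub_neq0 t ar => h; field.
apply.
- move=> b bd; have br := inr _ bd; split.
  + exact: cauchy2_cts01.
  + move=> t t01; apply: ctsM.
      apply: ctsM; first exact: phic.
      by apply: ctsD; exact: circ_sub_cts.
    apply: ctsV; first by rewrite mulf_neq0 ?expf_neq0 ?circ_sub_neq0.
    by apply: ctsM; apply: ctsM; exact: circ_sub_cts.
  + move=> t t01; have := circ_sub_neq0 t ar; have := circ_sub_neq0 t br.
    by rewrite /Q => h1 h2; field; rewrite h1 h2.
- have sa t : {for (t, a), continuous (fun x : R * C => gam x.1 - a)}.
    by apply: ctsB; [exact: gamfst|exact: cts_cst].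
  have sb t : {for (t, a), continuous (fun x : R * C => gam x.1 - x.2)}.
    by apply: ctsB; [exact: gamfst|exact: sndc].
  move=> t t01; apply: ctsM.
    apply: ctsM; first exact: phifst.
    by apply: ctsD; [exact: sa|exact: sb].
  apply: ctsV; first by rewrite mulf_neq0 ?expf_neq0 ?circ_sub_neq0.
  apply: ctsM; apply: ctsM; [exact: sa|exact: sa|exact: sb|exact: sb].
Qed.

End Circle.

(** The derivative in [a] is the integral of an exact form, hence 0; at the centre
    the integrand is constantly 1. *)
Lemma winding c r a : 0 < r -> cabs (a - c) < r ->
  integral01 (fun t => (circ c r t - c) / (circ c r t - a)) = 1.
Proof.
move=> r0 ar; pose phi t := circ c r t - c.
have phic : cts01 phi by move=> t _; exact: circ_sub_cts.
pose N := cauchy1 c r phi.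
have N0 b : cabs (b - c) < r -> cauchy2 c r phi b = 0.
  move=> br; rewrite /cauchy2.
  have := @circ_int_primitive (fun w => (w - b) ^- 2 / twopii R)
    (fun w => - (w - b)^-1 / twopii R) c r _.
  have -> : (fun t => (circ c r t - b) ^- 2 / twopii R * (twopii R * (circ c r t - c))) =
     (fun t => phi t / (circ c r t - b) ^+ 2).
    apply/funext => t; rewrite /phi; have := circ_sub_neq0 r0 t br => h.
    by have := twopii_neq0 R => h'; field; rewrite h h'.
  apply => t _; have h := circ_sub_neq0 r0 t br.
  have := cderivM (cderivN (cderivV (f := fun w => w - b) h (cderiv_subr b _)))
    (cderiv_cst (twopii R)^-1 (circ c r t)).
  by rewrite mulr0 addr0 mulN1r opprK.
have NE : N a = N c.
  apply/eqP; rewrite -subr_eq0 -cabs_eq0 eq_le cabs_ge0 andbT.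
  have := @seg_mvt _ N (cauchy2 c r phi) c a 0; rewrite mul0r; apply.
    move=> t t01; apply: cauchy1_deriv => //.
    by apply: disc_convex => //; rewrite /disc /= subrr cabs0.
  move=> t t01; rewrite N0 ?cabs0//.
  by apply: disc_convex => //; rewrite /disc /= subrr cabs0.
transitivity (N a); first by [].
rewrite NE /N /cauchy1 /phi.
have -> : (fun t => (circ c r t - c) / (circ c r t - c)) = fun=> 1.
  apply/funext => t; rewrite divff// circ_sub_neq0// subrr cabs0//.
exact: integral01_cst.
Qed.

(** The difference quotient of [f] at [a] has a primitive, so its integral over the
    circle vanishes.  What remains is [f a] times the winding number.  The factor
    [circ c r t - c] is the derivative of the parametrisation, up to [2 pi i]. *)
Theorem cauchy_formula W f c r a : openC W -> convexC W -> holo W f ->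
  0 < r -> (forall w, cabs (w - c) <= r -> W w) -> cabs (a - c) < r ->
  cts01 (fun t => f (circ c r t) * (circ c r t - c)) /\
  f a = cauchy1 c r (fun t => f (circ c r t) * (circ c r t - c)) a.
Proof.
move=> oW cW hf r0 rW ar.
have Wg t : W (circ c r t) by apply: (rW); rewrite circ_abs ?lexx ?(ltW r0).
have Wa : W a by apply: (rW); exact: ltW.
have fgc : cts01 (fun t => f (circ c r t)).
  move=> t _; apply: (cts_comp (f := circ c r)); first exact: circ_cts.
  exact: holo_cts hf (Wg t).
have phic : cts01 (fun t => f (circ c r t) * (circ c r t - c)).
  by move=> t t01; apply: ctsM; [exact: fgc|exact: circ_sub_cts].
split => //; have [D da] := hf a Wa.
have [G dG] := dslope_primitive oW cW Wa hf da.
have := @circ_int_primitive (dslope f a D) G c r (fun t _ => dG _ (Wg t)).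
have idc : cts01 (fun t => circ c r t - c) by move=> t _; exact: circ_sub_cts.
have c1 := cauchy1_cts01 r0 phic ar; have c2 := cauchy1_cts01 r0 idc ar.
have -> : (fun t => dslope f a D (circ c r t) * (twopii R * (circ c r t - c))) =
   (fun t => twopii R * (f (circ c r t) * (circ c r t - c) / (circ c r t - a) -
     f a * ((circ c r t - c) / (circ c r t - a)))).
  apply/funext => t; have h := circ_sub_neq0 r0 t ar.
  rewrite /dslope -[X in if X then _ else _]subr_eq0 (negbTE h).
  by field.
have c2' : cts01 (fun t => f a * ((circ c r t - c) / (circ c r t - a))).
  by move=> t t01; apply: ctsM; [exact: cts_cst|exact: c2].
rewrite integral01Z; last by move=> t t01; apply: ctsB; [exact: c1|exact: c2'].
rewrite (integral01B c1 c2') (integral01Z _ c2) winding// mulr1 => /eqP.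
rewrite mulf_eq0 (negbTE (twopii_neq0 R)) /= subr_eq0 => /eqP <-.
by [].
Qed.

End Cauchy.

(** * Holomorphic functions *)

Section Holomorphic.
Variable R : realType.
Local Notation C := (R[i]^o).
Implicit Types (f g : C -> C) (a b c z w p : C) (s t r : R) (W : set C).

(** The derivative is only known through its characteristic property: unfolding a
    choice operator in the course of unification is costly. *)
Lemma deriv_exists : {D : (C -> C) -> C -> C |
  forall f z l, cderiv f z l -> D f z = l}.
Proof.
exists (fun f z => xget 0 [set l | cderiv f z l]) => f z l df.
by case: xgetP => [m _ dm|/(_ l)]; [exact: cderiv_unique dm df|case].
Qed.

Definition deriv : (C -> C) -> C -> C := sval deriv_exists.

Lemma derivE f z l : cderiv f z l -> deriv f z = l.
Proof. exact: (svalP deriv_exists). Qed.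

Lemma derivP f z : (exists l, cderiv f z l) -> cderiv f z (deriv f z).
Proof. by move=> [l dl]; rewrite (derivE dl). Qed.

Lemma holo_derivP W f z : holo W f -> W z -> cderiv f z (deriv f z).
Proof. by move=> h /h/derivP. Qed.

Lemma sub_holo W V f : V `<=` W -> holo W f -> holo V f.
Proof. by move=> VW hf z /VW/hf. Qed.

Lemma holo_ext W f g : openC W -> (forall z, W z -> f z = g z) ->
  holo W f -> holo W g.
Proof.
move=> oW fg hf z Wz; have [l df] := hf z Wz; have [r r0 Hr] := oW z Wz.
by exists l; apply: (cderiv_local r0) df => w /Hr/fg.
Qed.

Lemma holo_cst W c : holo W (fun=> c).
Proof. by move=> z _; exists 0; exact: cderiv_cst. Qed.
Lemma holo_id W : holo W (fun z => z).
Proof. by move=> z _; exists 1; exact: cderiv_id. Qed.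
Lemma holoD W f g : holo W f -> holo W g -> holo W (fun z => f z + g z).
Proof.
by move=> hf hg z Wz; have [l df] := hf z Wz; have [m dg] := hg z Wz;
  eexists; exact: (cderivD df dg).
Qed.
Lemma holoB W f g : holo W f -> holo W g -> holo W (fun z => f z - g z).
Proof.
by move=> hf hg z Wz; have [l df] := hf z Wz; have [m dg] := hg z Wz;
  eexists; exact: (cderivB df dg).
Qed.
Lemma holoM W f g : holo W f -> holo W g -> holo W (fun z => f z * g z).
Proof.
by move=> hf hg z Wz; have [l df] := hf z Wz; have [m dg] := hg z Wz;
  eexists; exact: (cderivM df dg).
Qed.
Lemma holoX W f n : holo W f -> holo W (fun z => f z ^+ n).
Proof.
move=> hf; elim: n => [|n ih]; first exact: (holo_cst 1).
have -> : (fun z => f z ^+ n.+1) = (fun z => f z * f z ^+ n).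
  by apply/funext => z; rewrite exprS.
exact: (holoM hf ih).
Qed.
Lemma holoV W f : (forall z, W z -> f z != 0) -> holo W f ->
  holo W (fun z => (f z)^-1).
Proof.
by move=> f0 hf z Wz; have [l df] := hf z Wz; eexists;
  exact: (cderivV (f0 z Wz) df).
Qed.
Lemma holo_comp W V f g : (forall z, W z -> V (f z)) -> holo W f -> holo V g ->
  holo W (fun z => g (f z)).
Proof.
by move=> WV hf hg z Wz; have [l df] := hf z Wz; have [m dg] := hg _ (WV _ Wz);
  eexists; exact: (cderiv_comp df dg).
Qed.
Lemma holo_cexp W f : holo W f -> holo W (fun z => cexp (f z)).
Proof.
by move=> hf z Wz; have [l df] := hf z Wz; eexists; exact: cderiv_cexp df.
Qed.

Section OnCircle.
Variables (W : set C) (f : C -> C) (c : C) (r : R).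
Hypotheses (oW : openC W) (cW : convexC W) (hf : holo W f) (r0 : 0 < r).
Hypothesis rW : forall w, cabs (w - c) <= r -> W w.

Let phi t := f (circ c r t) * (circ c r t - c).

Let phic : cts01 phi.
Proof.
by apply: (cauchy_formula oW cW hf r0 rW (a := c) _).1; rewrite subrr cabs0.
Qed.

Let phiE a : cabs (a - c) < r -> f a = cauchy1 c r phi a.
Proof. by move=> ar; exact: (cauchy_formula oW cW hf r0 rW ar).2. Qed.

Lemma circle_near a : cabs (a - c) < r ->
  exists2 d : R, 0 < d & forall w, cabs (w - a) < d -> cabs (w - c) < r.
Proof. exact: disc_open. Qed.

Lemma cauchy2_is_deriv a : cabs (a - c) < r -> cderiv f a (cauchy2 c r phi a).
Proof.
move=> ar; have [d d0 Hd] := circle_near ar.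
by apply: (cderiv_local d0) (cauchy1_deriv r0 phic ar) => w /Hd/phiE ->.
Qed.

(** Near [a] the derivative is a Cauchy transform, hence differentiable. *)
Lemma deriv_derivable a : cabs (a - c) < r -> exists l, cderiv (deriv f) a l.
Proof.
move=> ar; have [d d0 Hd] := circle_near ar.
eexists; apply: (cderiv_local d0) (cauchy2_deriv r0 phic ar) => w /Hd wr.
by rewrite (derivE (cauchy2_is_deriv wr)).
Qed.

Variable M : R.
Hypothesis fM : forall t, 0 <= t <= 1 -> cabs (f (circ c r t)) <= M.

Lemma cauchy_bound a : cabs (a - c) < r -> cabs (f a) <= M * (r / (r - cabs (a - c))).
Proof.
move=> ar; rewrite (phiE ar); apply: integral01_le.
  exact: cauchy1_cts01.
move=> t t01; rewrite !cabsM cabsV circ_abs ?(ltW r0)// -mulrA.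
have h : 0 < r - cabs (a - c) by rewrite subr_gt0.
have h' : r - cabs (a - c) <= cabs (circ c r t - a).
  by have := cabsT a (circ c r t) c; rewrite circ_abs ?(ltW r0)//; lra.
apply: ler_pM; [exact: cabs_ge0| |exact: fM|].
  by rewrite mulr_ge0 ?(ltW r0)// invr_ge0 cabs_ge0.
rewrite ler_wpM2l ?(ltW r0)// lef_pV2// posrE//.
exact: lt_le_trans h'.
Qed.

Lemma max_center : cabs (f c) <= M.
Proof.
have := @cauchy_bound c; rewrite subrr cabs0 subr0 divff ?gt_eqF// mulr1.
exact.
Qed.

Lemma cauchy_estimate : cabs (deriv f c) <= M / r.
Proof.
have cr : cabs (c - c) < r by rewrite subrr cabs0.
rewrite (derivE (cauchy2_is_deriv cr)); apply: integral01_le.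
  exact: cauchy2_cts01.
move=> t t01; have := circ_sub_neq0 r0 t cr => h.
rewrite /phi expr2 invfM mulrA mulfK// cabsM cabsV circ_abs ?(ltW r0)//.
by rewrite ler_wpM2r ?fM// invr_ge0 ltW.
Qed.

End OnCircle.

Lemma circ_bounded f c r :
  (forall t, 0 <= t <= 1 -> {for circ c r t, continuous f}) ->
  exists2 M : R, 0 <= M & forall t, 0 <= t <= 1 -> cabs (f (circ c r t)) <= M.
Proof.
move=> fc; have [||u _ Hu] := @EVT_max R (fun t => cabs (f (circ c r (clamp t)))) 0 1.
- exact: ler01.
- apply: continuous_subspaceT => t; apply: (@cts_cabs R R).
  apply: (cts_comp (f := fun t => circ c r (clamp t))).
    by apply: (cts_comp (f := @clamp R)); [exact: clamp_cts|exact: circ_cts].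
  exact: (fc _ (clamp01 t)).
exists (cabs (f (circ c r (clamp u)))); first exact: cabs_ge0.
move=> t t01; have := Hu t; rewrite clamp_id//; apply.
by rewrite in_itv.
Qed.

Theorem holo_deriv W f : openC W -> holo W f -> holo W (deriv f).
Proof.
move=> oW hf z Wz; have [r r0 Hr] := oW z Wz.
have r2 : 0 < r / 2 by rewrite divr_gt0.
apply: (@deriv_derivable (disc z r) f z (r / 2)) => //.
- exact: disc_open.
- exact: disc_convex.
- by apply: sub_holo hf => w /Hr.
- by move=> w; rewrite /disc /=; lra.
- by rewrite subrr cabs0.
Qed.

(** The difference quotient at the zero has a primitive, so it is a derivative, and
    derivatives are holomorphic: the singularity at [a] is removable. *)
Theorem factor_zero W f a : openC W -> convexC W -> W a -> holo W f ->
  f a = 0 -> exists2 g, holo W g & forall z, f z = (z - a) * g z.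
Proof.
move=> oW cW Wa hf fa; have da := holo_derivP hf Wa.
have [G dG] := dslope_primitive oW cW Wa hf da.
exists (dslope f a (deriv f a)); last first.
  by move=> z; rewrite {1}(dslopeE f a (deriv f a) z) fa add0r.
apply: (@holo_ext _ (deriv G)) => //; first by move=> z /dG/derivE.
by apply: holo_deriv => // z /dG dz; eexists; exact: dz.
Qed.

Lemma deriv0_const W f a b : convexC W -> W a -> W b ->
  (forall z, W z -> cderiv f z 0) -> f a = f b.
Proof.
move=> cW Wa Wb df; apply/esym/eqP.
rewrite -subr_eq0 -cabs_eq0 eq_le cabs_ge0 andbT.
have := @seg_mvt _ f (fun=> 0) a b 0; rewrite mul0r; apply.
  by move=> t t01; apply: df; exact: cW.
by move=> t _; rewrite cabs0.
Qed.

(** A primitive of [f' / f] is a logarithm up to a multiplicative constant. *)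
Theorem holo_log W f p : openC W -> convexC W -> W p -> holo W f ->
  (forall z, W z -> f z != 0) ->
  exists2 L, holo W L & forall z, W z -> cexp (L z) = f z.
Proof.
move=> oW cW Wp hf f0; pose q z := deriv f z * (f z)^-1.
have hq : holo W q.
  by apply: holoM; [exact: holo_deriv|exact: holoV].
pose L z := seg_int q p z.
have dL z : W z -> cderiv L z (q z).
  move=> Wz; apply: (star_primitive oW cW Wp) Wz => [w Ww|w Ww _].
    exact: holo_cts hq Ww.
  exact: hq.
pose h z := f z * cexp (- L z).
have dh z : W z -> cderiv h z 0.
  move=> Wz; have := cderivM (holo_derivP hf Wz) (cderiv_cexp (cderivN (dL z Wz))).
  have -> : deriv f z * cexp (- L z) + f z * (cexp (- L z) * - q z) = 0.
    by rewrite /q; have := f0 z Wz => f0z; field.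
  exact.
have hE z : W z -> h z = h p by move=> Wz; exact: (deriv0_const cW Wz Wp dh).
have hp0 : h p != 0 by rewrite mulf_neq0 ?f0 ?cexp_neq0.
have [k kE] := cexp_surj hp0.
exists (fun z => L z + k).
  by apply: holoD; [move=> z /dL dz; eexists; exact: dz|exact: holo_cst].
move=> z Wz; rewrite cexpD kE -(hE z Wz) /h mulrCA.
by rewrite [cexp (L z) * _]mulrC cexpN mulr1.
Qed.

Lemma exists_near a (d : R) : 0 < d -> exists2 w, w != a & cabs (w - a) < d.
Proof.
move=> d0; exists (a + (d / 2)%:C).
  rewrite -subr_eq0 addrAC subrr add0r -cabs_gt0 cabsr gtr0_norm divr_gt0//.
by rewrite addrAC subrr add0r cabsr gtr0_norm; lra.
Qed.

Lemma near_zero_cts f a (d : R) : 0 < d -> {for a, continuous f} ->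
  (forall w, w != a -> cabs (w - a) < d -> f w = 0) -> f a = 0.
Proof.
move=> d0 fc f0; apply/eqP; apply: contraT => fa.
have fa0 : 0 < cabs (f a) by rewrite cabs_gt0.
have [d' d'0 Hd] := (cts_cabsP _ _).1 fc _ fa0.
have m0 : 0 < Num.min d d' by rewrite lt_min d0.
have [w wa] := exists_near a m0; rewrite lt_min => /andP[h1 h2].
by have := Hd w h2; rewrite f0// sub0r cabsN ltxx.
Qed.

(** The function is divisible by every power of [z - a].  By Cauchy's bound on a
    circle of radius more than twice [|z - a|], division by the n-th power gains
    a factor [2 ^- n] at [z], so that [f z] is arbitrarily small. *)
Theorem identity_theorem f a (d : R) : holo setT f -> 0 < d ->
  (forall z, cabs (z - a) < d -> f z = 0) -> forall z, f z = 0.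
Proof.
move=> hf d0 fa0 z.
have oT := @openC_T R; have cT := @convexC_T R.
have pw n : exists2 g, holo setT g & forall z, f z = (z - a) ^+ n * g z.
  elim: n => [|n [g hg gE]]; first by exists f => // w; rewrite expr0 mul1r.
  have ga : g a = 0.
    apply: (near_zero_cts d0); first exact: holo_cts hg I.
    move=> w wa wd; have := fa0 w wd; rewrite gE => /eqP.
    rewrite mulf_eq0 expf_eq0 => /orP[/andP[_]|/eqP //].
    by rewrite subr_eq0 (negbTE wa).
  have [k hk kE] := factor_zero oT cT I hg ga.
  by exists k => // w; rewrite gE kE exprSr mulrA.
pose r := 2 * cabs (z - a) + 1.
have za := cabs_ge0 (z - a).
have r0 : 0 < r by rewrite /r; lra.
have zr : cabs (z - a) < r by rewrite /r; lra.
have [M M0 HM] := @circ_bounded f a r (fun t _ => holo_cts hf I).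
pose K := M * (r / (r - cabs (z - a))).
have H n : cabs (f z) <= K / 2 ^+ n.
  have [g hg gE] := pw n.
  have gM t : 0 <= t <= 1 -> cabs (g (circ a r t)) <= M / r ^+ n.
    move=> t01; rewrite ler_pdivlMr ?exprn_gt0//.
    by have := HM t t01; rewrite gE cabsM cabsX circ_abs ?(ltW r0)// mulrC.
  have := cauchy_bound oT cT hg r0 (fun _ _ => I) gM zr.
  rewrite gE cabsM cabsX => /(ler_wpM2l (exprn_ge0 n za)) /le_trans; apply.
  have -> : cabs (z - a) ^+ n * (M / r ^+ n * (r / (r - cabs (z - a)))) =
      K * (cabs (z - a) / r) ^+ n.
    by rewrite /K expr_div_n; ring.
  rewrite ler_wpM2l//.
    by rewrite /K mulr_ge0// divr_ge0 ?(ltW r0)// subr_ge0 ltW.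
  rewrite -exprVn lerXn2r ?nnegrE ?divr_ge0 ?(ltW r0) ?invr_ge0//.
  by rewrite ler_pdivrMr// /r; lra.
apply/eqP; rewrite -cabs_eq0 eq_le cabs_ge0 andbT leNgt; apply/negP => fz0.
have [n] := exists_pow2_small K fz0.
by apply/negP; rewrite -leNgt.
Qed.

Lemma holo_mul_eq0 f g a : holo setT f -> holo setT g ->
  (forall z, f z * g z = 0) -> f a != 0 -> forall z, g z = 0.
Proof.
move=> hf hg fg fa; have fa0 : 0 < cabs (f a) by rewrite cabs_gt0.
have [d d0 Hd] := (cts_cabsP _ _).1 (holo_cts hf (I : setT a)) _ fa0.
apply: (identity_theorem hg d0) => z /Hd h; have /eqP := fg z.
rewrite mulf_eq0 => /orP[/eqP fz|/eqP //].
by move: h; rewrite fz sub0r cabsN ltxx.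
Qed.

End Holomorphic.

(** * Square roots and Bloch's theorem *)

Section SquareRoot.
Variable R : realType.
Local Notation C := (R[i]^o).
Implicit Types (f g : C -> C) (a b c z w p : C) (s t r : R).

Lemma cancel_factor f g a : holo setT f -> holo setT g ->
  (forall z, (z - a) * f z = (z - a) * g z) -> forall z, f z = g z.
Proof.
move=> hf hg E z.
have off w : w != a -> f w - g w = 0.
  move=> wa; have wa0 : w - a != 0 by rewrite subr_eq0.
  by rewrite (mulfI wa0 (E w)) subrr.
apply/eqP; rewrite -subr_eq0; have [->|/off ->//] := eqVneq z a.
apply/eqP; apply: (@near_zero_cts _ (fun w => f w - g w) a 1) => //.
  by apply: holo_cts (I : setT a); exact: holoB.
by move=> w /off.
Qed.

(** A zero of [F] that is not one of [A] is a zero of [V], hence a double zero of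
    [F]; removing it keeps the relation with [A]. *)
Lemma divide_double_zero F A V a :
  holo setT F -> holo setT A -> holo setT V ->
  (forall z, F z * A z = V z ^+ 2) -> F a = 0 -> A a != 0 ->
  exists G V', [/\ holo setT G, holo setT V',
    forall z, F z = (z - a) ^+ 2 * G z & forall z, G z * A z = V' z ^+ 2].
Proof.
move=> hF hA hV E Fa Aa; have oT := @openC_T R; have cT := @convexC_T R.
have Va : V a = 0.
  by have /esym/eqP := E a; rewrite Fa mul0r expf_eq0 => /eqP.
have [F1 hF1 F1E] := factor_zero oT cT I hF Fa.
have [V1 hV1 V1E] := factor_zero oT cT I hV Va.
have hid : holo setT (fun z => z - a) by apply: holoB; [exact: holo_id|exact: holo_cst].
have E1 z : F1 z * A z = (z - a) * V1 z ^+ 2.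
  apply: (@cancel_factor (fun z => F1 z * A z) (fun z => (z - a) * V1 z ^+ 2) a).
  - exact: holoM.
  - by apply: holoM => //; exact: holoX.
  by move=> w; rewrite mulrA -F1E E V1E; ring.
have F1a : F1 a = 0.
  have /eqP := E1 a; rewrite subrr mul0r mulf_eq0 (negbTE Aa) orbF.
  by move/eqP.
have [G hG GE] := factor_zero oT cT I hF1 F1a.
exists G, V1; split => // z; first by rewrite F1E GE; ring.
apply: (@cancel_factor (fun z => G z * A z) (fun z => V1 z ^+ 2) a).
- exact: holoM.
- exact: holoX.
by move=> w; rewrite mulrA -GE E1.
Qed.

(** The relation with [A] and [V] says that all zeros of [F] have even order.  They
    are removed two at a time until none is left in the disc, where a logarithm
    then provides the square root.  This stops: by the maximum principle on the
    circle of radius [3 r], each removal in the disc of radius [r] lowers the bound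
    on [F 0] by a factor 4. *)
Theorem holo_sqrt F A V r : 0 < r ->
  holo setT F -> holo setT A -> holo setT V ->
  (forall z, F z * A z = V z ^+ 2) -> (forall z, F z = 0 -> A z != 0) ->
  F 0 != 0 ->
  exists2 s, holo (disc 0 r) s & forall z, disc 0 r z -> s z ^+ 2 = F z.
Proof.
move=> r0 hF hA hV FA nz F0; have oT := @openC_T R; have cT := @convexC_T R.
pose good := exists2 s, holo (disc 0 r) s & forall z, disc 0 r z -> s z ^+ 2 = F z.
have [//|ng] := pselect good; exfalso.
(* After [n] steps, [Q] is the product of the [n] linear factors removed twice,
   and [H] is the remaining factor. *)
have step n : exists Q H V', [/\ holo setT Q, holo setT H, holo setT V' &
   [/\ forall z, F z = Q z ^+ 2 * H z, forall z, H z * A z = V' z ^+ 2,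
     forall z, H z = 0 -> A z != 0,
     cabs (F 0) <= r ^+ (2 * n) * cabs (H 0) &
     forall t, cabs (H (circ 0 (3 * r) t)) * (2 * r) ^+ (2 * n) <=
        cabs (F (circ 0 (3 * r) t))]].
  elim: n => [|n [Q [H [V' [hQ hH hV' [FE HA Hn H0 Hc]]]]]].
    exists (fun=> 1), F, V; split => //; first exact: holo_cst.
    split => //; first by move=> z; rewrite expr1n mul1r.
      by rewrite muln0 expr0 mul1r.
    by move=> t; rewrite muln0 expr0 mulr1.
  have [Hd|] := pselect (forall z, disc 0 r z -> H z != 0).
    exfalso; apply: ng.
    have d0 : disc 0 r (0 : C) by rewrite /disc /= subrr cabs0.
    have [L hL LE] := holo_log (@disc_open R 0 r) (@disc_convex R 0 r) d0
      (sub_holo (fun _ _ => I) hH) Hd.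
    exists (fun z => Q z * cexp (L z * 2%:R^-1)).
      apply: holoM; first exact: sub_holo hQ.
      by apply: holo_cexp; apply: holoM; [exact: hL|exact: holo_cst].
    move=> z /LE HzE; rewrite exprMn FE -HzE -cexp_natM; congr (_ * cexp _).
    by field.
  move/existsNP => [a /not_implyP[da /negP/negPn/eqP Ha]].
  have [G [V1 [hG hV1 GE GA]]] := divide_double_zero hH hA hV' HA Ha (Hn _ Ha).
  exists (fun z => Q z * (z - a)), G, V1; split => //.
    by apply: holoM => //; apply: holoB; [exact: holo_id|exact: holo_cst].
  have ar : cabs a < r by move: da; rewrite /disc /= subr0.
  split => //.
  - by move=> z; rewrite FE GE; ring.
  - by move=> z Gz; apply: Hn; rewrite GE Gz mulr0.
  - apply: (le_trans H0); rewrite GE sub0r cabsM cabsX cabsN mulnS addnC exprD -mulrA.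
    rewrite ler_wpM2l ?exprn_ge0 ?(ltW r0)// ler_wpM2r ?cabs_ge0//.
    by rewrite lerXn2r ?nnegrE ?cabs_ge0 ?(ltW r0)// ltW.
  - move=> t; apply: le_trans (Hc t); rewrite GE cabsM cabsX.
    rewrite mulnS exprD mulrA ler_wpM2r ?exprn_ge0 ?mulr_ge0 ?(ltW r0)//.
    rewrite mulrC ler_wpM2r ?cabs_ge0//.
    rewrite lerXn2r ?nnegrE ?cabs_ge0 ?mulr_ge0 ?(ltW r0)//.
    have := @circ_abs R 0 (3 * r) t; rewrite mulr_ge0 ?(ltW r0)// subr0 => /(_ isT).
    by have := cabsT a (circ 0 (3 * r) t) 0; rewrite !subr0; lra.
have r3 : 0 < 3 * r by rewrite mulr_gt0.
have [M M0 HM] := @circ_bounded R F 0 (3 * r) (fun t _ => holo_cts hF I).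
have bound n : cabs (F 0) <= M / 2 ^+ n.
  have [Q [H [V' [_ hH _ [_ _ _ H0 Hc]]]]] := step n.
  have r2 : 0 < (2 * r) ^+ (2 * n) by rewrite exprn_gt0// mulr_gt0.
  have HMc t : 0 <= t <= 1 -> cabs (H (circ 0 (3 * r) t)) <= M / (2 * r) ^+ (2 * n).
    by move=> t01; rewrite ler_pdivlMr//; apply: le_trans (Hc t) (HM t t01).
  have := max_center oT cT hH r3 (fun _ _ => I) HMc.
  have rp : 0 < r ^+ (2 * n) by rewrite exprn_gt0.
  move=> /(ler_wpM2l (ltW rp)) /(le_trans H0) /le_trans; apply.
  have -> : r ^+ (2 * n) * (M / (2 * r) ^+ (2 * n)) = M / 2 ^+ (2 * n).
    have p2 : (2 : R) ^+ (2 * n) != 0 by rewrite expf_neq0.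
    by rewrite exprMn; field; rewrite p2 gt_eqF.
  rewrite ler_wpM2l// lef_pV2 ?posrE ?exprn_gt0//.
  by rewrite ler_weXn2l ?ler1n// leq_pmull.
have F0' : 0 < cabs (F 0) by rewrite cabs_gt0.
have [n] := exists_pow2_small M F0'.
by apply/negP; rewrite -leNgt.
Qed.

End SquareRoot.

Section Bloch.
Variable R : realType.
Local Notation C := (R[i]^o).
Implicit Types (f g : C -> C) (a b c z w p : C) (s t r : R).

(** Compactness is transported from the real plane. *)
Lemma square_compact (r : R) :
  compact ((fun x : R * R => (x.1 +i* x.2 : C)) @`
    (`[- r, r]%classic `*` `[- r, r]%classic)).
Proof.
apply: continuous_compact; last first.
  by apply: compact_setX; exact: segment_compact.
by apply: continuous_subspaceT => x; apply: cvg_complex; [exact: cvg_fst|exact: cvg_snd].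
Qed.

Lemma closed_disc_compact c r : compact [set z : C | cabs (z - c) <= r].
Proof.
have sc z : {for z, continuous (fun z : C => cabs (z - c))}.
  by apply: cts_cabs; apply: ctsB; [exact: idC_cts|exact: cts_cst].
apply: (@subclosed_compact _ _ ((fun x : R * R => (x.1 +i* x.2 : C)) @`
   (`[- (r + cabs c), r + cabs c]%classic `*` `[- (r + cabs c), r + cabs c]%classic))).
- apply: (@closed_comp _ _ (fun z : C => cabs (z - c)) [set x | x <= r]).
    by move=> z _; exact: sc.
  exact: closed_le.
- exact: square_compact.
move=> z /= zr; have zb : cabs z <= r + cabs c.
  by have := cabsD (z - c) c; rewrite subrK; lra.
exists (complex.Re z, complex.Im z); last by case: (z).
have := Re_le_cabs z; have := Im_le_cabs z.
by split; rewrite /= in_itv /= -ler_norml; lra.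
Qed.

Lemma closed_disc_max (h : C -> R) c r : 0 <= r ->
  (forall z, cabs (z - c) <= r -> {for z, continuous h}) ->
  exists2 p, cabs (p - c) <= r & forall z, cabs (z - c) <= r -> h z <= h p.
Proof.
move=> r0 hc.
have [|||p /set_mem pK Hp] := @compact_EVT_max _ R h [set z : C | cabs (z - c) <= r].
- by exists c; rewrite /= subrr cabs0.
- exact: closed_disc_compact.
- by apply: continuous_in_subspaceT => z /set_mem; exact: hc.
by exists p => // z zr; apply: Hp; exact: mem_set.
Qed.

Lemma seg_closed_disc c r x y t : 0 <= t <= 1 -> cabs (x - c) <= r ->
  cabs (y - c) <= r -> cabs (seg x y t - c) <= r.
Proof.
move=> t01 xr yr.
have -> : seg x y t - c = (1 - t)%:C * (x - c) + t%:C * (y - c).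
  by rewrite /seg !realCE; ring.
apply: le_trans (cabsD _ _) _; rewrite !cabsM !cabsr !ger0_norm; try lra.
nra.
Qed.

(** As [m'] varies by at most half of its value at [p], Newton's map [Psi] is a
    contraction of the closed disc.  Its fixed point is obtained as a minimum of
    [|z - Psi z|]. *)
Lemma covers_disc W m p (d : R) : 0 < d -> holo W m ->
  (forall z, cabs (z - p) <= d -> W z) ->
  (forall z, cabs (z - p) <= d ->
     cabs (deriv m z - deriv m p) <= cabs (deriv m p) / 2) ->
  deriv m p != 0 ->
  forall w, cabs (w - m p) <= d * cabs (deriv m p) / 2 ->
  exists2 z, cabs (z - p) <= d & m z = w.
Proof.
move=> d0 hm dW near m0 w wp; set M := cabs _ in near wp.
have M0 : 0 < M by rewrite cabs_gt0.
pose Psi z := z - (m z - w) / deriv m p.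
have dPsi z : cabs (z - p) <= d -> cderiv Psi z (1 - deriv m z / deriv m p).
  move=> zd; have Wz := dW z zd.
  have h := cderivM (cderivB (holo_derivP hm Wz) (cderiv_cst w z))
    (cderiv_cst (deriv m p)^-1 z).
  have := cderivB (cderiv_id z) h.
  by rewrite mulr0 addr0 subr0.
have lip x y : cabs (x - p) <= d -> cabs (y - p) <= d ->
    cabs (Psi y - Psi x) <= 1 / 2 * cabs (y - x).
  move=> xd yd; apply: (seg_mvt (f := fun z => 1 - deriv m z / deriv m p)).
    by move=> t t01; apply: dPsi; exact: seg_closed_disc.
  move=> t t01; have := near _ (seg_closed_disc t01 xd yd); set z := seg x y t.
  have -> : 1 - deriv m z / deriv m p = (deriv m p - deriv m z) / deriv m p.
    by rewrite mulrBl divff.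
  by rewrite cabsM cabsV -/M cabsC ler_pdivrMr// mul1r mulrC.
have Psic z : cabs (z - p) <= d -> {for z, continuous Psi}.
  by move=> /dPsi; exact: cderiv_cts.
have [|z zd zmin] := @closed_disc_max (fun z => 0 - cabs (z - Psi z)) p d (ltW d0).
  move=> z zd; apply: (@ctsBR R C (fun=> 0)); first exact: cts_cstR.
  by apply: cts_cabs; apply: ctsB; [exact: idC_cts|exact: Psic].
exists z => //.
have pd : cabs (p - p) <= d by rewrite subrr cabs0 ltW.
have Pp : cabs (Psi p - p) <= d / 2.
  rewrite /Psi addrAC subrr add0r cabsN cabsM cabsV -/M cabsC ler_pdivrMr//.
  by rewrite mulrAC.
have Pzd : cabs (Psi z - p) <= d.
  have := cabsT (Psi p) (Psi z) p; have := lip _ _ pd zd; lra.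
have := zmin _ Pzd; have := lip _ _ Pzd zd; rewrite cabsC => h1 h2.
have : cabs (z - Psi z) <= 0.
  have := lip _ _ zd Pzd; rewrite (cabsC (Psi z) z) (cabsC (Psi (Psi z))); lra.
rewrite /Psi opprB addrCA subrr addr0 => h.
have /eqP : cabs ((m z - w) / deriv m p) == 0 by rewrite eq_le h cabs_ge0.
move=> /eqP; rewrite cabs_eq0 mulf_eq0 invr_eq0 (negbTE m0) orbF subr_eq0.
by move/eqP.
Qed.

(** Choose [p] maximising [(r - |z|) |m' z|].  On the disc of radius
    [t = (r - |p|) / 2] about [p] the derivative is at most twice its value at [p],
    so Cauchy's estimate bounds [m''], and [m'] varies by at most half of its value
    on the disc of radius [t / 8].  By the choice of [p], the product [t |m' p|] is
    at least [r |m' 0| / 2]. *)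
Theorem bloch m (r r' : R) : 0 < r -> r < r' -> holo (disc 0 r') m ->
  deriv m 0 != 0 ->
  exists p, forall w, cabs (w - m p) <= r * cabs (deriv m 0) / 32 ->
    exists z, [/\ disc 0 r' z, m z = w & deriv m z != 0].
Proof.
move=> r0 rr' hm m0; have oW := @disc_open R 0 r'; have cW := @disc_convex R 0 r'.
have hm' := holo_deriv oW hm; have hm'' := holo_deriv oW hm'.
have inW z : cabs (z - 0) <= r -> disc 0 r' z by move=> h; rewrite /disc /=; lra.
have [|p pr pmax] := @closed_disc_max (fun z => (r - cabs z) * cabs (deriv m z)) 0 r (ltW r0).
  move=> z zr; apply: ctsMR.
    by apply: ctsBR; [exact: cts_cstR|exact: continuous_cabs].
  by apply: cts_cabs; exact: (holo_cts hm' (inW z zr)).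
rewrite subr0 in pr; set M := cabs (deriv m p) in pmax.
have m00 : 0 < cabs (deriv m 0) by rewrite cabs_gt0.
have hp0 : r * cabs (deriv m 0) <= (r - cabs p) * M.
  by have := pmax 0; rewrite subrr cabs0 subr0 => /(_ (ltW r0)).
have prod0 : 0 < (r - cabs p) * M by apply: lt_le_trans hp0; rewrite mulr_gt0.
have M0 : 0 < M.
  rewrite lt_neqAle eq_sym cabs_ge0 andbT; apply: contraTneq prod0 => ->.
  by rewrite mulr0 ltxx.
have rp : 0 < r - cabs p by move: prod0; rewrite pmulr_lgt0.
pose t := (r - cabs p) / 2; have t0 : 0 < t by rewrite divr_gt0.
have rt : r - cabs p = 2 * t by rewrite /t; field.
have zabs z : cabs z <= cabs (z - p) + cabs p by have := cabsD (z - p) p; rewrite subrK.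
have near2 z : cabs (z - p) <= t -> cabs (deriv m z) <= 2 * M.
  move=> zt; have := zabs z => zz.
  have := pmax z; rewrite subr0 => /(_ _) h.
  have {}h : (r - cabs z) * cabs (deriv m z) <= (r - cabs p) * M by apply: h; lra.
  have := cabs_ge0 (deriv m z) => d0.
  have : t * cabs (deriv m z) <= t * (2 * M).
    apply: le_trans (_ : (r - cabs z) * cabs (deriv m z) <= _).
      by rewrite ler_wpM2r//; lra.
    by apply: (le_trans h); rewrite rt; lra.
  by rewrite ler_pM2l.
have Wt z : cabs (z - p) <= t -> disc 0 r' z.
  by move=> zt; apply: inW; rewrite subr0; have := zabs z; lra.
have est z : cabs (z - p) <= t / 2 -> cabs (deriv (deriv m) z) <= 4 * M / t.
  move=> zt; have t2 : 0 < t / 2 by rewrite divr_gt0.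
  have -> : 4 * M / t = 2 * M / (t / 2) by field; rewrite gt_eqF.
  apply: (cauchy_estimate oW cW hm' t2).
    by move=> w wz; apply: Wt; have := cabsT z w p; lra.
  move=> u u01; apply: near2; have := circ_abs z u (ltW t2).
  by have := cabsT z (circ z (t / 2) u) p; lra.
have nearp z : cabs (z - p) <= t / 8 -> cabs (deriv m z - deriv m p) <= M / 2.
  move=> zt; have pp : cabs (p - p) <= t / 8 by rewrite subrr cabs0 divr_ge0// ltW.
  apply: le_trans (seg_mvt (f := deriv (deriv m)) (M := 4 * M / t) _ _) _.
  - move=> u u01; apply: holo_derivP hm' _; apply: Wt.
    have := seg_closed_disc u01 pp zt; lra.
  - move=> u u01; apply: est; have := seg_closed_disc u01 pp zt; lra.
  have -> : M / 2 = 4 * M / t * (t / 8) by field; rewrite gt_eqF.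
  have k0 : 0 < 4 * M / t by rewrite divr_gt0// mulr_gt0.
  exact: ler_wpM2l (ltW k0) _ _ zt.
have mp0 : deriv m p != 0 by rewrite -cabs_gt0.
have t8 : 0 < t / 8 by rewrite divr_gt0.
exists p => w wp.
have [||z zt mz] := covers_disc t8 hm _ nearp mp0 (w := w).
- by move=> z zt; apply: Wt; lra.
- apply: (le_trans wp); rewrite -/M.
  have -> : t / 8 * M / 2 = (r - cabs p) * M / 32 by rewrite rt; field.
  by rewrite ler_wpM2r.
exists z; split => //; first by apply: Wt; lra.
apply: contraTneq (nearp z zt) => ->; rewrite sub0r cabsN -/M -ltNge; lra.
Qed.

End Bloch.

(** * Functions ramified over the integers *)

Section Ramified.
Variable R : realType.
Local Notation C := (R[i]^o).
Implicit Types (f g : C -> C) (a b c z w p : C) (s t r : R).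

Lemma cexp_int (j : int) : cexp (j%:~R * twopii R) = 1.
Proof.
case: j => n; first by rewrite -pmulrn cexp_natM cexp_2pii expr1n.
by rewrite NegzE mulrNz mulNr cexpNV -pmulrn cexp_natM cexp_2pii expr1n invr1.
Qed.

(** The number [y] is the inverse hyperbolic cosine of an integer close to [exp x],
    which is the logarithm of [n + sqrt (n ^ 2 - 1)]. *)
Lemma near_log_int (x : R) : 0 <= x ->
  exists (n : nat) (y : R), [/\ (2 <= n)%N, x <= y, y <= x + ln 6 &
    expR y + expR (- y) = 2 * n%:R].
Proof.
move=> x0; have e1 : 1 <= expR x by rewrite -expR0 ler_expR.
pose n := (Num.trunc (expR x)).+2.
have nl : expR x <= n%:R.
  by apply/ltW/(lt_trans (truncnS_gt _)); rewrite ltr_nat.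
have nu : n%:R <= 3 * expR x.
  have : (Num.trunc (expR x))%:R <= expR x by rewrite truncn_le ltW ?expR_gt0.
  by rewrite /n -!natr1; lra.
have n2 : (2 <= n)%N by [].
have n2R : 2 <= n%:R :> R by rewrite (ler_nat _ 2).
pose q := Num.sqrt (n%:R ^+ 2 - 1 : R).
have q2 : q ^+ 2 = n%:R ^+ 2 - 1.
  by rewrite sqr_sqrtr// subr_ge0 -[1](expr1n _ 2) lerXn2r ?nnegrE//; lra.
have q0 : 0 <= q by exact: sqrtr_ge0.
have qn : q <= n%:R.
  by rewrite -(ler_sqr q0) ?nnegrE// ?q2; lra.
have u0 : 0 < n%:R + q by lra.
exists n, (ln (n%:R + q)); split => //.
- by rewrite -[x]expRK ler_ln ?posrE ?expR_gt0//; lra.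
- have -> : x + ln 6 = ln (expR x * 6) by rewrite lnM ?posrE ?expR_gt0// expRK.
  by rewrite ler_ln ?posrE ?mulr_gt0 ?expR_gt0//; lra.
rewrite expRN lnK ?posrE//.
have -> : (n%:R + q)^-1 = n%:R - q.
  apply: (mulfI (lt0r_neq0 u0)); rewrite divff ?gt_eqF//.
  have -> : (n%:R + q) * (n%:R - q) = n%:R ^+ 2 - q ^+ 2 by ring.
  by rewrite q2; ring.
ring.
Qed.

(** The real part is adjusted by [near_log_int], and the imaginary part by a
    multiple of [2 pi]. *)
Lemma cosh_int_dense : exists2 B : R, 0 < B & forall w : C,
  exists (n : nat) z, [/\ (2 <= n)%N, cabs (z - w) <= B &
    cexp z + cexp (- z) = 2%:R * n%:R].
Proof.
have pi0 := @pi_gt0 R.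
have l6 : 0 < ln 6 :> R by rewrite ln_gt0// ltr1n.
exists (ln 6 + 2 * pi); first by lra.
case=> x y.
have [n [v [n2 xv vx nE]]] := near_log_int (normr_ge0 x).
pose j := Num.floor (y / (pi *+ 2)).
have p20 : 0 < pi *+ 2 :> R by rewrite mulrn_wgt0.
have j1 : (j%:~R) * (pi *+ 2) <= y by rewrite -ler_pdivlMr// ge_floor.
have j2 : y < (j%:~R + 1) * (pi *+ 2).
  by rewrite -ltr_pdivrMr// -[1]/(1%:~R) -intrD lt_succ_floor.
have [x1 x1E x1x] : exists2 x1 : R,
    expR x1 + expR (- x1) = 2 * n%:R & `|x1 - x| <= ln 6.
  have [x0|x0] := leP 0 x.
    rewrite ger0_norm// in xv vx; exists v => //.
    by rewrite ler_norml; apply/andP; split; lra.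
  rewrite ltr0_norm// in xv vx; exists (- v); first by rewrite opprK addrC.
  by rewrite ler_norml; apply/andP; split; lra.
exists n, (x1%:C + j%:~R * twopii R); split => //.
  apply: le_trans (cabs_le _) _.
  have -> : (j%:~R : C) = (j%:~R : R)%:C by rewrite rmorph_int.
  rewrite /twopii; simpc => /=.
  rewrite lerD// ler_norml; apply/andP; split; rewrite mulr2n in j1 j2 *; lra.
rewrite opprD !cexpD (cexpNV (j%:~R * _)) cexp_int invr1 !mulr1.
by rewrite -realCN !cexp_real -realCD x1E realCM !realC_nat.
Qed.

(** The hypotheses on [A] and [V] express that [K] takes the values 1 and
    -1 with even multiplicity.  If [K'] did not vanish at [z0], then on large discs
    about [z0] one could write [K = cosh m].  The derivative of [m] at the centre
    does not depend on the disc, so by Bloch's theorem [m] takes, at a point where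
    [m' <> 0], a value whose hyperbolic cosine is an integer [n >= 2].  There
    [K = n], so that [K' = 0] and then [m' = 0]. *)
Theorem ramified_const K A V :
  holo setT K -> holo setT A -> holo setT V ->
  (forall z, (K z ^+ 2 - 1) * A z = V z ^+ 2) ->
  (forall z, K z ^+ 2 - 1 = 0 -> A z != 0) ->
  (forall z n, (2 <= n)%N -> K z = n%:R -> deriv K z = 0) ->
  forall z, deriv K z = 0.
Proof.
move=> hK hA hV FA An Kn z0; apply/eqP; apply: contraT => K'0.
have [B B0 HB] := cosh_int_dense.
pose F z := K z ^+ 2 - 1.
have hF : holo setT F by apply: holoB; [exact: holoX|exact: holo_cst].
have dK z : cderiv K z (deriv K z) by exact: holo_derivP hK I.
have dF z : cderiv F z (2%:R * K z * deriv K z).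
  have := cderivB (cderivX 1 (dK z)) (cderiv_cst 1 z).
  by rewrite expr1 subr0.
(* At a zero of [F] the relation with [A] and [V] gives [F' = 2 K K' = 0]. *)
have Fz0 : F z0 != 0.
  apply: contraNneq K'0 => Fz; have Az := An _ Fz.
  have Vz : V z0 = 0.
    by have /esym/eqP := FA z0; rewrite -/(F z0) Fz mul0r expf_eq0 => /eqP.
  have d1 := cderivM (dF z0) (holo_derivP hA I).
  have d2 := cderivX 1 (holo_derivP hV (I : setT z0)).
  have d3 : cderiv (fun w => V w ^+ 2) z0 _ :=
    cderiv_local ltr01 (fun w _ => FA w) d1.
  have := cderiv_unique d3 d2; rewrite Vz Fz expr1 mul0r addr0 mulr0 mul0r.
  move=> /eqP; rewrite mulf_eq0 (negbTE Az) orbF mulf_eq0 => /orP[|//].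
  rewrite mulf_eq0 pnatr_eq0 /= => /eqP Kz.
  by move/eqP: Fz; rewrite /F Kz expr0n sub0r oppr_eq0 oner_eq0.
pose tr z := z + z0.
have htr : holo setT tr by apply: holoD; [exact: holo_id|exact: holo_cst].
have hFt : holo setT (fun z => F (tr z)) := holo_comp (fun _ _ => I) htr hF.
have hAt : holo setT (fun z => A (tr z)) := holo_comp (fun _ _ => I) htr hA.
have hVt : holo setT (fun z => V (tr z)) := holo_comp (fun _ _ => I) htr hV.
have tr0 : tr 0 = z0 by rewrite /tr add0r.
have dKt z : cderiv (fun z => K (tr z)) z (deriv K (tr z)).
  have d1 := cderivD (cderiv_id z) (cderiv_cst z0 z).
  have := cderiv_comp (f := tr) d1 (dK (tr z)).
  by rewrite addr0 mulr1.
(* The modulus of [m' 0], for every disc. *)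
pose q := cabs (deriv K z0) / Num.sqrt (cabs (F z0)).
have F0 : 0 < Num.sqrt (cabs (F z0)) by rewrite sqrtr_gt0 cabs_gt0.
have q0 : 0 < q by rewrite divr_gt0// cabs_gt0.
pose r := 32 * B / q; have r0 : 0 < r by rewrite divr_gt0// mulr_gt0.
pose W := disc (0 : C) (r + 1).
have oW : openC W by exact: disc_open.
have cW : convexC W by exact: disc_convex.
have W0 : W 0 by rewrite /W /disc /= subrr cabs0; lra.
have [s hs sE] : exists2 s, holo W s & forall z, W z -> s z ^+ 2 = F (tr z).
  apply: (holo_sqrt _ hFt hAt hVt) => //; last by rewrite tr0.
  - by lra.
  - by move=> z; exact: FA.
  - by move=> z; exact: An.
have KsE z : W z -> (K (tr z) + s z) * (K (tr z) - s z) = 1.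
  move=> /sE E; have -> : (K (tr z) + s z) * (K (tr z) - s z) = K (tr z) ^+ 2 - s z ^+ 2.
    by ring.
  by rewrite E /F; ring.
have Ks0 z : W z -> K (tr z) + s z != 0.
  by move=> /KsE; apply: contra_eqN => /eqP ->; rewrite mul0r eq_sym oner_eq0.
have hKt : holo W (fun z => K (tr z)) by move=> z _; eexists; exact: dKt.
have [m hm mE] := holo_log oW cW W0 (holoD hKt hs) Ks0.
(* From [exp m = K + s] and [s ^ 2 = K ^ 2 - 1]: this is [sinh m * m' = K']. *)
have smK z : W z -> s z * deriv m z = deriv K (tr z).
  move=> Wz; have ds := holo_derivP hs Wz; have dm := holo_derivP hm Wz.
  have [d d0 Hd] := oW z Wz.
  have e1 : s z * deriv s z = K (tr z) * deriv K (tr z).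
    have d1 : cderiv (fun z => F (tr z)) z _ :=
      cderiv_local d0 (fun w h => sE w (Hd w h)) (cderivX 1 ds).
    have d2 := cderivB (cderivX 1 (dKt z)) (cderiv_cst 1 z).
    have := cderiv_unique d1 d2; rewrite !expr1 subr0 -!mulrA.
    by move/mulfI; apply; rewrite pnatr_eq0.
  have e2 : deriv K (tr z) + deriv s z = (K (tr z) + s z) * deriv m z.
    have d1 : cderiv (fun z => K (tr z) + s z) z _ :=
      cderiv_local d0 (fun w h => mE w (Hd w h)) (cderiv_cexp dm).
    by rewrite (cderiv_unique (cderivD (dKt z) ds) d1) mE.
  apply: (mulfI (Ks0 z Wz)); rewrite mulrCA -e2 mulrDr e1; ring.
have m0 : cabs (deriv m 0) = q.
  have := smK 0 W0; rewrite tr0 => /(congr1 (@cabs R)); rewrite cabsM => E.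
  have s0 : cabs (s 0) = Num.sqrt (cabs (F z0)).
    by rewrite -tr0 -(sE 0 W0) cabsX sqrtr_sqr ger0_norm// cabs_ge0.
  by rewrite /q -E s0 mulrAC divff ?mul1r// gt_eqF.
have dm0 : deriv m 0 != 0 by rewrite -cabs_gt0 m0.
have rr : r < r + 1 by lra.
have [p Hp] := bloch r0 rr hm dm0.
have [n [m1 [n2 m1p m1E]]] := HB (m p).
have [|z [Wz mz dmz]] := Hp m1.
  apply: (le_trans m1p); rewrite m0 /r.
  by rewrite mulfVK ?gt_eqF// mulrAC divff ?mul1r// pnatr_eq0.
have KzE : K (tr z) = n%:R.
  have e1 := mE z Wz.
  have e2 : cexp (- m z) = K (tr z) - s z.
    apply: (mulfI (Ks0 z Wz)); rewrite KsE// -e1.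
    by rewrite mulrC cexpN.
  move: m1E; rewrite -mz e1 e2 addrACA subrr addr0 => E.
  have two0 : (2%:R : C) != 0 by rewrite pnatr_eq0.
  by apply: (mulfI two0); rewrite -E; ring.
have := smK z Wz; rewrite (Kn _ _ n2 KzE) => /eqP.
rewrite mulf_eq0 (negbTE dmz) orbF => /eqP sz.
have := sE z Wz; rewrite sz /F KzE expr0n /= => /eqP.
rewrite eq_sym subr_eq0 -natrX -[1]/(1%:R) eqr_nat.
by case: (n) n2 => [|[|k]].
Qed.

End Ramified.

(** * The plane curve attached to a quartic *)

Section Curve.
Variable R : realType.
Local Notation C := (R[i]^o).
Implicit Types (f g u v : C -> C) (a b c z w p : C).

Lemma deriv_const_entire f a b : holo setT f -> (forall z, deriv f z = 0) ->
  f a = f b.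
Proof.
move=> hf d0; apply: (deriv0_const (@convexC_T R) I I) => z _.
by rewrite -(d0 z); exact: holo_derivP hf I.
Qed.

(** The zeros of [exp (2 pi i z) - 1] at 1 and -1 are simple, since its derivative
    there is [2 pi i]. *)
Lemma cexp_factor : exists2 E : C -> C, holo setT E &
  (forall z, cexp (z * twopii R) - 1 = (z ^+ 2 - 1) * E z) /\
  (forall z, z ^+ 2 - 1 = 0 -> E z != 0).
Proof.
have oT := @openC_T R; have cT := @convexC_T R.
pose e z : C := cexp (z * twopii R) - 1.
have he : holo setT e.
  apply: holoB; last exact: holo_cst.
  by apply: holo_cexp; apply: holoM; [exact: holo_id|exact: holo_cst].
have e1 : e 1 = 0 by rewrite /e mul1r cexp_2pii subrr.
have eN1 : e (-1) = 0 by rewrite /e mulN1r cexpNV cexp_2pii invr1 subrr.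
have [E1 h1 E1E] := factor_zero oT cT I he e1.
have E1N1 : E1 (-1) = 0.
  have /esym/eqP := E1E (-1); rewrite eN1 mulf_eq0 => /orP[|/eqP //].
  by rewrite -opprD oppr_eq0 -[1 + 1]/(2%:R) pnatr_eq0.
have [E h EE] := factor_zero oT cT I h1 E1N1.
have eE z : e z = (z ^+ 2 - 1) * E z by rewrite E1E EE; ring.
exists E => //; split; first exact: eE.
move=> z z1; have z0 : z != 0.
  by apply: contra_eqN z1 => /eqP ->; rewrite expr0n sub0r oppr_eq0 oner_eq0.
have d1 := cderivM (cderivB (cderivX 1 (cderiv_id z)) (cderiv_cst 1 z))
  (holo_derivP h (I : setT z)).
have d0 := cderivB (cderiv_cexp (cderivM (cderiv_id z)
  (cderiv_cst (twopii R) z))) (cderiv_cst 1 z).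
have d2 : cderiv (fun w => (w ^+ 2 - 1) * E w) z _ :=
  cderiv_local ltr01 (fun w _ => eE w) d0.
have := cderiv_unique d1 d2.
have -> : cexp (z * twopii R) = 1.
  by have := eE z; rewrite z1 mul0r => /eqP; rewrite subr_eq0 => /eqP.
rewrite z1 mul0r addr0 subr0 mulr0 addr0 !mul1r subr0 expr1 mulr1 => E2.
apply: contraNneq (twopii_neq0 R) => Ez.
by rewrite -E2 Ez mulr0.
Qed.

(** If a root [be] of the cubic is double, then the third root is [- 2 be], because
    the roots add up to 0, and it is simple because [be <> 0]. *)
Lemma simple_root a b : b != 0 -> exists al : C,
  [/\ al != 0, al ^+ 3 + 2%:R * a * al + 2%:R * b = 0 &
      3%:R * al ^+ 2 + 2%:R * a != 0].
Proof.
move=> b0; pose q : {poly R[i]} := 'X^3 + (2%:R * a) *: 'X + (2%:R * b)%:P.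
have qs : size q = 4%N.
  rewrite /q -addrA size_polyDl size_polyXn//.
  apply: (leq_ltn_trans (size_polyD _ _)); rewrite gtn_max.
  rewrite (leq_ltn_trans (size_scale_leq _ _)) ?size_polyX//.
  by rewrite (leq_ltn_trans (size_polyC_leq1 _)).
have [be be0] : exists x, root q x by apply/closed_rootP; rewrite qs.
have two0 : (2%:R : C) != 0 by rewrite pnatr_eq0.
have beE : be ^+ 3 + 2%:R * a * be + 2%:R * b = 0.
  by move: be0; rewrite /root /q !hornerE => /eqP.
have rn0 (x : C) : x ^+ 3 + 2%:R * a * x + 2%:R * b = 0 -> x != 0.
  move=> xE; apply: contraNneq b0 => x0; move/eqP: xE.
  by rewrite x0 expr0n mulr0 !add0r mulf_eq0 (negbTE two0).
have [ds|ds] := eqVneq (3%:R * be ^+ 2 + 2%:R * a) 0; last first.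
  by exists be; split => //; exact: rn0.
have aE : 2%:R * a = - (3%:R * be ^+ 2).
  by apply/eqP; rewrite -addr_eq0 addrC ds.
have bE : 2%:R * b = 2%:R * be ^+ 3.
  apply/eqP; rewrite -subr_eq0 -beE aE; apply/eqP; ring.
exists (- (2%:R * be)).
have rE : (- (2%:R * be)) ^+ 3 + 2%:R * a * - (2%:R * be) + 2%:R * b = 0.
  by rewrite aE bE; ring.
split; [exact: rn0|exact: rE|].
have -> : 3%:R * (- (2%:R * be)) ^+ 2 + 2%:R * a = 9%:R * be ^+ 2.
  by rewrite aE; ring.
by rewrite mulf_neq0 ?pnatr_eq0// expf_neq0// rn0.
Qed.

(** The function [u] is zero-free as [b <> 0], and [u = al exp (2 pi i K)] for a
    simple root [al] of the cubic.  Where [K] is an integer, [u = al], hence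
    [v = 0], and the derivative of the identity gives [u' = 0].  At the zeros of
    [K ^ 2 - 1] the same identity shows that multiplying by a function without a
    zero there gives a square. *)
Theorem curve_unit_const u v a b : b != 0 -> holo setT u -> holo setT v ->
  (forall z, u z * v z ^+ 2 + (u z ^+ 3 + 2%:R * a * u z + 2%:R * b) = 0) ->
  forall z w, u z = u w.
Proof.
move=> b0 hu hv uv.
have oT := @openC_T R; have cT := @convexC_T R.
have two0 : (2%:R : C) != 0 by rewrite pnatr_eq0.
have u0 z : setT z -> u z != 0.
  move=> _; apply: contraNneq b0 => uz; move/eqP: (uv z).
  by rewrite uz expr0n mul0r mulr0 !add0r mulf_eq0 (negbTE two0).
have [al [al0 alE als]] := simple_root a b0.
have [h hh hE] := holo_log oT cT (I : setT 0) hu u0.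
have [k kE] := cexp_surj al0.
pose K z := (h z - k) * (twopii R)^-1.
have tp0 := twopii_neq0 R.
have hK : holo setT K.
  by apply: holoM; [apply: holoB; [exact: hh|exact: holo_cst]|exact: holo_cst].
have uK z : u z = al * cexp (K z * twopii R).
  by rewrite /K mulfVK// -kE -cexpD addrC subrK hE.
have [E hE' [EE En]] := cexp_factor.
pose q x := x ^+ 2 + al * x + (al ^+ 2 + 2%:R * a) : C.
have pq x : x ^+ 3 + 2%:R * a * x + 2%:R * b = (x - al) * q x.
  by rewrite -[LHS]subr0 -[X in _ - X]alE /q; ring.
pose A z := - (al * E (K z) * q (u z) * u z).
pose V z := v z * u z.
have hq : holo setT (fun z => q (u z)).
  apply: holoD; last exact: holo_cst.
  by apply: holoD; [exact: holoX|apply: holoM; [exact: holo_cst|]].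
have hEK : holo setT (fun z => E (K z)) by exact: (holo_comp (V := setT)).
have hA : holo setT A.
  have -> : A = fun z => 0 - al * E (K z) * q (u z) * u z.
    by apply/funext => z; rewrite sub0r.
  apply: holoB; first exact: holo_cst.
  apply: holoM => //; apply: holoM => //; apply: holoM => //; exact: holo_cst.
have hV : holo setT V by exact: holoM.
have KA z : (K z ^+ 2 - 1) * A z = V z ^+ 2.
  have e1 : (K z ^+ 2 - 1) * E (K z) * al = u z - al.
    by rewrite -EE uK; ring.
  have -> : (K z ^+ 2 - 1) * A z =
      - ((K z ^+ 2 - 1) * E (K z) * al * q (u z)) * u z by rewrite /A; ring.
  rewrite e1 -pq; have /eqP := uv z; rewrite addrC addr_eq0 => /eqP ->.
  by rewrite /V; ring.
have An z : K z ^+ 2 - 1 = 0 -> A z != 0.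
  move=> Kz; have uz : u z = al.
    have := EE (K z); rewrite Kz mul0r => /eqP; rewrite subr_eq0 => /eqP e1.
    by rewrite uK e1 mulr1.
  rewrite /A oppr_eq0 uz !mulf_neq0// ?En//.
  by have -> : q al = 3%:R * al ^+ 2 + 2%:R * a by rewrite /q; ring.
have dh z : deriv h z = deriv u z / u z.
  have d1 := cderiv_cexp (holo_derivP hh (I : setT z)).
  have d2 := cderiv_local ltr01 (fun w _ => hE w I) d1.
  by rewrite (derivE d2) hE// mulrAC divff ?mul1r// u0.
have dK z : deriv K z = deriv u z / u z / twopii R.
  rewrite -dh; apply: derivE.
  have := cderivM (cderivB (holo_derivP hh (I : setT z)) (cderiv_cst k z))
    (cderiv_cst (twopii R)^-1 z).
  by rewrite mulr0 addr0 subr0.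
have Kn z n : (2 <= n)%N -> K z = n%:R -> deriv K z = 0.
  move=> _ Kz; have uz : u z = al.
    by rewrite uK Kz cexp_natM cexp_2pii expr1n mulr1.
  have vz : v z = 0.
    have /eqP := uv z; rewrite pq uz subrr mul0r addr0 mulf_eq0 (negbTE al0) /=.
    by rewrite expf_eq0 => /eqP.
  have du := holo_derivP hu (I : setT z).
  have d1 := cderivD (cderivM du (cderivX 1 (holo_derivP hv (I : setT z))))
    (cderivD (cderivD (cderivX 2 du) (cderivM (cderivM (cderiv_cst 2%:R z)
      (cderiv_cst a z)) du)) (cderivM (cderiv_cst 2%:R z) (cderiv_cst b z))).
  have d2 := cderiv_local ltr01 (fun w _ => uv w) d1.
  have := cderiv_unique d2 (cderiv_cst 0 z); rewrite vz uz => e1.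
  have : deriv u z * (3%:R * al ^+ 2 + 2%:R * a) = 0.
    by rewrite -e1; ring.
  move=> /eqP; rewrite mulf_eq0 (negbTE als) orbF dK => /eqP ->.
  by rewrite !mul0r.
have K0 := ramified_const hK hA hV KA An Kn.
move=> z w; have Kzw : K z = K w by exact: (deriv_const_entire z w hK K0).
by rewrite (uK z) (uK w) Kzw.
Qed.

Lemma const_of_sqr v : holo setT v -> (forall z w, v z ^+ 2 = v w ^+ 2) ->
  forall z w, v z = v w.
Proof.
move=> hv vv z w; have [v0|v0] := eqVneq (v w) 0.
  by rewrite v0; have /eqP := vv z w; rewrite v0 expr0n expf_eq0 => /eqP.
apply: (deriv_const_entire z w hv) => x.
have d1 := cderivX 1 (holo_derivP hv (I : setT x)).
have d2 := cderiv_local ltr01 (fun y _ => vv y w) d1.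
have /eqP := cderiv_unique d2 (cderiv_cst _ x).
rewrite !mulf_eq0 pnatr_eq0 /= expr1 => /orP[/eqP vx|/eqP //].
by have /eqP := vv w x; rewrite vx expr0n expf_eq0 (negbTE v0).
Qed.

(** The function [f - g] times [Q] vanishes identically, and the identity theorem
    lets one cancel [f - g]. *)
Theorem quartic_unique f g a b : b != 0 -> holo setT f -> holo setT g ->
  (forall z, f z ^+ 4 + a * f z ^+ 2 + b * f z =
             g z ^+ 4 + a * g z ^+ 2 + b * g z) ->
  (forall z, f z = g z) \/ (forall z w, f z = f w).
Proof.
move=> b0 hf hg fg; have [|] := pselect (forall z, f z = g z); first by left.
move=> /existsNP[z1 /eqP fg1]; right.
have two0 : (2%:R : C) != 0 by rewrite pnatr_eq0.
pose u z := f z + g z; pose v z := f z - g z.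
have hu : holo setT u by exact: holoD.
have hv : holo setT v by exact: holoB.
pose Q z := u z * (f z ^+ 2 + g z ^+ 2 + a) + b.
have hQ : holo setT Q.
  apply: holoD; last exact: holo_cst.
  apply: holoM => //; apply: holoD; last exact: holo_cst.
  by apply: holoD; exact: holoX.
have vQ z : v z * Q z = 0.
  have -> : v z * Q z = (f z ^+ 4 + a * f z ^+ 2 + b * f z) -
     (g z ^+ 4 + a * g z ^+ 2 + b * g z) by rewrite /v /Q /u; ring.
  by rewrite fg subrr.
have v1 : v z1 != 0 by rewrite subr_eq0.
have Q0 := holo_mul_eq0 hv hQ vQ v1.
have uvE z : u z * v z ^+ 2 + (u z ^+ 3 + 2%:R * a * u z + 2%:R * b) = 0.
  have -> : u z * v z ^+ 2 + (u z ^+ 3 + 2%:R * a * u z + 2%:R * b) = 2%:R * Q z.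
    by rewrite /Q /v /u; ring.
  by rewrite Q0 mulr0.
have uc := curve_unit_const b0 hu hv uvE.
have un0 z : u z != 0.
  apply: contraNneq b0 => uz; move/eqP: (uvE z).
  by rewrite uz expr0n mul0r mulr0 !add0r mulf_eq0 (negbTE two0).
have vc := const_of_sqr hv (_ : forall z w, v z ^+ 2 = v w ^+ 2).
move=> z w; apply: (mulfI two0).
have fE x : 2%:R * f x = u x + v x by rewrite /u /v; ring.
rewrite !fE (uc z w); congr (_ + _); apply: vc => {z w} z w.
apply: (mulfI (un0 z)); apply: (addIr (u z ^+ 3 + 2%:R * a * u z + 2%:R * b)).
by rewrite uvE -(uvE w) (uc w z).
Qed.

End Curve.

(** * Quartic polynomials *)

Section Quartic.
Variable R : realType.
Local Notation C := (R[i]).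
Implicit Types (P : {poly R[i]}).

Lemma quartic_depressed P : size P = 5%N -> exists k e a b c : R[i],
  [/\ k != 0,
      forall x, P.[x] = k * ((x + e) ^+ 4 + a * (x + e) ^+ 2 + b * (x + e) + c) &
      forall x, P^`().[x] =
        k * (4%:R * (x + e) ^+ 3 + 2%:R * a * (x + e) + b)].
Proof.
move=> sP; have k0 : P`_4 != 0.
  have : lead_coef P != 0 by rewrite lead_coef_eq0 -size_poly_eq0 sP.
  by rewrite lead_coefE sP.
have PE x : P.[x] = P`_0 + P`_1 * x + P`_2 * x ^+ 2 + P`_3 * x ^+ 3 + P`_4 * x ^+ 4.
  rewrite (@horner_coef_wide _ 5); last by rewrite sP.
  by rewrite !big_ord_recr big_ord0 /= add0r expr0 mulr1 expr1.
have P'E x : P^`().[x] = P`_1 + 2%:R * P`_2 * x + 3%:R * P`_3 * x ^+ 2 +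
    4%:R * P`_4 * x ^+ 3.
  rewrite (@horner_coef_wide _ 4); last first.
    by rewrite -ltnS -sP lt_size_deriv// -size_poly_eq0 sP.
  rewrite !big_ord_recr big_ord0 /= add0r expr0 mulr1 expr1 !coef_deriv.
  ring.
have n4 : (4%:R : R[i]) != 0 by rewrite pnatr_eq0.
have n2 : (2%:R : R[i]) != 0 by rewrite pnatr_eq0.
pose e := P`_3 / (4%:R * P`_4).
pose a := P`_2 / P`_4 - 6%:R * e ^+ 2.
pose b := P`_1 / P`_4 - 4%:R * e ^+ 3 - 2%:R * a * e.
pose c := P`_0 / P`_4 - e ^+ 4 - a * e ^+ 2 - b * e.
have E3 : P`_3 = 4%:R * P`_4 * e by rewrite /e mulrCA divff ?mulr1// mulf_neq0.
have E2 : P`_2 = P`_4 * (a + 6%:R * e ^+ 2).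
  by rewrite /a subrK mulrCA divff ?mulr1.
have E1 : P`_1 = P`_4 * (b + 2%:R * a * e + 4%:R * e ^+ 3).
  by rewrite /b !subrK mulrCA divff ?mulr1.
have E0 : P`_0 = P`_4 * (c + b * e + a * e ^+ 2 + e ^+ 4).
  by rewrite /c !subrK mulrCA divff ?mulr1.
exists P`_4, e, a, b, c; split=> // x.
  by rewrite PE E0 E1 E2 E3; ring.
by rewrite P'E E1 E2 E3; ring.
Qed.

(** With [S = D + D'], the hypotheses give [b = S ^ 3] and
    [2 S (D - D') ^ 2 = 0]. *)
Lemma quartic_symmetric (a b D D' : R[i]) : D != D' ->
  4%:R * D ^+ 3 + 2%:R * a * D + b = 0 ->
  4%:R * D' ^+ 3 + 2%:R * a * D' + b = 0 ->
  D ^+ 4 + a * D ^+ 2 + b * D = D' ^+ 4 + a * D' ^+ 2 + b * D' ->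
  D' = - D /\ b = 0.
Proof.
move=> DD c1 c2 vv; have d0 : D - D' != 0 by rewrite subr_eq0.
have e1 : 4%:R * (D ^+ 2 + D * D' + D' ^+ 2) + 2%:R * a = 0.
  apply: (mulfI d0); rewrite mulr0 -(subrr 0) -{2}c2 -{1}c1; ring.
have e2 : (D + D') * (D ^+ 2 + D' ^+ 2) + a * (D + D') + b = 0.
  apply: (mulfI d0); rewrite mulr0.
  by have /eqP := vv; rewrite -subr_eq0 => /eqP <-; ring.
have aE : 2%:R * a = - (4%:R * (D ^+ 2 + D * D' + D' ^+ 2)).
  by apply/eqP; rewrite -addr_eq0 addrC e1.
have n2 : (2%:R : R[i]) != 0 by rewrite pnatr_eq0.
have bE : b = (D + D') ^+ 3.
  apply: (mulfI n2); apply/eqP; rewrite -subr_eq0; apply/eqP.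
  have -> : 2%:R * b - 2%:R * (D + D') ^+ 3 =
    2%:R * ((D + D') * (D ^+ 2 + D' ^+ 2) + a * (D + D') + b) -
    (2%:R * a) * (D + D') - 2%:R * (D + D') * (D ^+ 2 + D' ^+ 2) -
    2%:R * (D + D') ^+ 3 by ring.
  by rewrite e2 aE; ring.
have S0 : D + D' = 0.
  have : 2%:R * (D + D') * (D - D') ^+ 2 = 0.
    have -> : 2%:R * (D + D') * (D - D') ^+ 2 =
      (4%:R * D ^+ 3 + 2%:R * a * D + b) + (4%:R * D' ^+ 3 + 2%:R * a * D' + b).
      by rewrite bE aE; ring.
    by rewrite c1 c2 addr0.
  move=> /eqP; rewrite mulf_eq0 expf_eq0 (negbTE d0) andbF orbF mulf_eq0.
  by rewrite (negbTE n2) => /eqP.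
split; last by rewrite bE S0 expr0n.
by apply/eqP; rewrite -addr_eq0 addrC S0.
Qed.

Lemma entire_holo (f : R[i] -> R[i]) : entire f <-> holo setT f.
Proof.
by split=> [h z _|h z]; [exact/derivable_cderiv/h|exact/derivable_cderiv/h].
Qed.

(** The point reflection that exchanges [d] and [d'] preserves [P], so it violates
    uniqueness when paired with the identity. *)
Lemma UPE_CIP P : size P = 5%N -> is_UPE P -> is_CIP P.
Proof.
move=> sP [_ U] d d' rd rd' dd' Pdd.
have [k [e [a [b [c [k0 PE P'E]]]]]] := quartic_depressed sP.
have crit x : root P^`() x -> 4%:R * (x + e) ^+ 3 + 2%:R * a * (x + e) + b = 0.
  by rewrite rootE P'E mulf_eq0 (negbTE k0) => /eqP.
have DD' : d + e != d' + e by apply/eqP => /addIr.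
have vv : (d + e) ^+ 4 + a * (d + e) ^+ 2 + b * (d + e) =
    (d' + e) ^+ 4 + a * (d' + e) ^+ 2 + b * (d' + e).
  by move: Pdd; rewrite !PE => /(mulfI k0)/addIr.
have [D'E b0] := quartic_symmetric DD' (crit _ rd) (crit _ rd') vv.
have e2 : d + d' = - (2%:R * e).
  by apply/eqP; rewrite -(inj_eq (addIr (2%:R * e))) addNr; apply/eqP;
    rewrite -(subrr (d + e)) -D'E; ring.
pose g (z : R[i]) := d + d' - z.
have fE : entire (fun z : R[i] => z) by apply/entire_holo; exact: holo_id.
have gE : entire g.
  by apply/entire_holo; apply: holoB; [exact: holo_cst|exact: holo_id].
have fn : nonconstant (fun z : R[i] => z).
  by move=> [x H]; have := H 1; rewrite -(H 0) => /eqP; rewrite oner_eq0.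
have gn : nonconstant g.
  move=> [x H]; have := H 1; rewrite -(H 0) /g => /addrI/eqP.
  by rewrite eqr_opp oner_eq0.
have Pfg z : P.[z] = P.[g z].
  rewrite !PE b0 /g e2; congr (k * _); ring.
have H := U _ g fE gE fn gn Pfg.
have := H 1; have := H 0; rewrite /g subr0 => <-; rewrite sub0r => /eqP.
by rewrite -addr_eq0 -[1 + 1]/(2%:R) pnatr_eq0.
Qed.

(** If [b = 0], then either [a = 0] and [P] has a single critical point, or the two
    opposite square roots of [- a / 2] are critical points with the same value. *)
Lemma CIP_UPE P : size P = 5%N -> (2 <= derivative_index P)%N ->
  is_CIP P -> is_UPE P.
Proof.
move=> sP iP CP; split; first by rewrite sP.
have [k [e [a [b [c [k0 PE P'E]]]]]] := quartic_depressed sP.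
have n2 : (2%:R : R[i]) != 0 by rewrite pnatr_eq0.
have n4 : (4%:R : R[i]) != 0 by rewrite pnatr_eq0.
have b0 : b != 0.
  apply/eqP => b0; have [a0|a0] := eqVneq a 0.
    have rE x : root P^`() x -> x = - e.
      rewrite rootE P'E a0 b0 mulr0 mul0r !addr0 !mulf_eq0 (negbTE k0) (negbTE n4) /=.
      by rewrite !orbb addr_eq0 => /eqP.
    move: iP; rewrite /derivative_index.
    have -> : [set x : R[i] | root P^`() x]%classic = [set - e]%classic.
      apply/seteqP; split=> x /=; first exact: rE.
      move=> ->; rewrite rootE P'E a0 b0 addNr expr0n.
      by rewrite !mulr0 !addr0 mulr0.
    by rewrite fset_set1 finmap.cardfs1.
  pose s := sqrtc (- a / 2%:R).
  have s2 : s ^+ 2 = - a / 2%:R by exact: sqr_sqrtc.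
  have s0 : s != 0.
    apply: contraNneq a0 => s0; move/esym/eqP: s2.
    by rewrite s0 expr0n mulf_eq0 invr_eq0 (negbTE n2) orbF oppr_eq0.
  have sa : a = - (2%:R * s ^+ 2) by rewrite s2; field.
  have ne : s - e <> - s - e.
    move=> /addIr/eqP; rewrite -addr_eq0 -mulr2n -mulr_natl mulf_eq0.
    by rewrite (negbTE n2) (negbTE s0).
  apply: (CP (s - e) (- s - e)) ne _.
  - by rewrite rootE P'E b0 subrK sa; apply/eqP; ring.
  - by rewrite rootE P'E b0 subrK sa; apply/eqP; ring.
  - by rewrite !PE b0 !subrK; ring.
move=> f g /entire_holo hf /entire_holo hg fn gn Pfg z.
have hfe : holo setT (fun w => f w + e) by apply: holoD => //; exact: holo_cst.
have hge : holo setT (fun w => g w + e) by apply: holoD => //; exact: holo_cst.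
have [|H|H] := quartic_unique (a := a) b0 hfe hge.
- by move=> w; have := Pfg w; rewrite !PE => /(mulfI k0)/addIr.
- exact: addIr (H z).
- by case: fn; exists (f 0) => w; exact: addIr (H w 0).
Qed.

End Quartic.

Theorem theorem3p8 (R : realType) (P : {poly R[i]})
    (degP : size P = 5%N) (indP : (2 <= derivative_index P)%N) :
  is_UPE P <-> is_CIP P.
Proof. by split; [exact: UPE_CIP|exact: CIP_UPE]. Qed.
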